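(* Let $T\colon\mathbb B\rightsquigarrow\mathbf{Prof}$ be a twisted normal lax functor, let $P_T\colon\mathrm{Elt}(T)\to\mathbb B$ be the projection from its double category of elements with its canonical cleavage, and let $\mathrm{Tw}(P_T)\colon\mathbb B\rightsquigarrow\mathbf{Prof}$ be the associated twisted functor. The following data is an invertible strict natural transformation $\gamma\colon T\Rightarrow\mathrm{Tw}(P_T)$: - for each object $x$, the functor $\gamma_x\colon Tx\to\mathrm{Tw}(P_T)(x)$ with $a\mapsto(x,a)$ and $(u\colon a\to b)\mapsto(1_x,T_x(u))$; - for each arrow $f\colon x\to z$, the cell $\gamma_f\colon(\gamma_x\mid Tf\to\mathrm{Tw}(P_T)(f)\mid\gamma_z)$ with components $Tf(a,c)\ni u\mapsto(f,u)\colon(x,a)\to(z,c)$; - for each proarrow $m\colon x\nrightarrow y$, the naturality comparison $\gamma_m$ is the loose identity.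
   Context: Conventions. A double category $\mathbb D$ means a pseudo double category: a category $\mathbb D_0$ of objects and arrows (tight morphisms), a category $\mathbb D_1$ of proarrows (loose morphisms, written $m\colon x\nrightarrow y$) and cells, functors $\mathrm{src},\mathrm{tgt}\colon\mathbb D_1\to\mathbb D_0$, loose composition $\odot$ (in diagrammatic order) and loose identities $\mathrm{id}_x$, with coherent invertible associators and unitors (usually elided). Composition in $\mathbb D_0$ and $\mathbb D_1$ is tight composition, written in diagrammatic order $f\cdot g=g\circ f$, $\alpha\cdot\beta$. $\alpha\colon(f\mid m\to n\mid g)$ denotes a cell with left arrow $f=\mathrm{src}\,\alpha$, top proarrow $m$, bottom proarrow $n$, right arrow $g=\mathrm{tgt}\,\alpha$; $1_m$ is the identity cell of $m$ for $\cdot$ and $\mathrm{id}_f$ the identity cell of $f$ for $\odot$. Twisted functors. A twisted doubly lax functor $F\colon\mathbb D\rightsquigarrow\mathbb E$ assigns to each object $x$ an object $Fx$; to each arrow $f\colon x\to y$ a proarrow $Ff\colon Fx\nrightarrow Fy$; to each proarrow $m\colon x\nrightarrow y$ an arrow $Fm\colon Fx\to Fy$; to each cell $\alpha\colon(f\mid m\to n\mid g)$ a cell $F\alpha\colon(Fm\mid Ff\to Fg\mid Fn)$; together with tight-to-loose comparison cells $F_{f,g}\colon(1_{Fx}\mid Ff\odot Fg\to F(f\cdot g)\mid 1_{Fz})$ for $x\xrightarrow{f}y\xrightarrow{g}z$ and $F_x\colon(1_{Fx}\mid\mathrm{id}_{Fx}\to F(1_x)\mid 1_{Fx})$, and loose-to-tight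 comparison cells $F^{m,n}\colon(Fm\cdot Fn\mid\mathrm{id}_{Fx}\to\mathrm{id}_{Fz}\mid F(m\odot n))$ for $x\stackrel{m}{\nrightarrow}y\stackrel{n}{\nrightarrow}z$ and $F^x\colon(1_{Fx}\mid\mathrm{id}_{Fx}\to\mathrm{id}_{Fx}\mid F(\mathrm{id}_x))$, such that: (1) $(F\alpha\odot F\beta)\cdot F_{f',g'}=F_{f,g}\cdot F(\alpha\cdot\beta)$ for $\alpha\colon(f\mid m\to n\mid f')$, $\beta\colon(g\mid n\to p\mid g')$; (2) $\mathrm{id}_{Fm}\cdot F_y=F_x\cdot F(1_m)$ for $m\colon x\nrightarrow y$; (3) $(F\alpha\cdot F\beta)\odot F^{m',n'}=F^{m,n}\odot F(\alpha\odot\beta)$ for $\alpha\colon(f\mid m\to m'\mid g)$, $\beta\colon(g\mid n\to n'\mid h)$; (4) $1_{Ff}\odot F^y=F^x\odot F(\mathrm{id}_f)$ for $f\colon x\to y$; (5) $(F_{f,g}\odot 1_{Fh})\cdot F_{f\cdot g,h}=(1_{Ff}\odot F_{g,h})\cdot F_{f,g\cdot h}$; (6) $(F_x\odot 1_{Ff})\cdot F_{1_x,f}=1_{Ff}=(1_{Ff}\odot F_y)\cdot F_{f,1_y}$; (7) for $w\stackrel{m}{\nrightarrow}x\stackrel{n}{\nrightarrow}y\stackrel{p}{\nrightarrow}z$ with associator $a\colon(m\odot n)\odot p\to m\odot(n\odot p)$: $(F^{m,n}\cdot\mathrm{id}_{Fp})\odot F^{m\odot n,p}\odot(F_w\cdot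 F(a))=(\mathrm{id}_{Fm}\cdot F^{n,p})\odot F^{m,n\odot p}\odot(\mathrm{id}_{F(m\odot(n\odot p))}\cdot F_z)$; (8) with unitors $\lambda_m\colon\mathrm{id}_x\odot m\to m$, $\rho_m\colon m\odot\mathrm{id}_y\to m$: $(F^x\cdot\mathrm{id}_{Fm})\odot F^{\mathrm{id}_x,m}\odot(F_x\cdot F(\lambda_m))=\mathrm{id}_{Fm}\cdot F_y=(\mathrm{id}_{Fm}\cdot F^y)\odot F^{m,\mathrm{id}_y}\odot(F_x\cdot F(\rho_m))$. $F$ is a twisted lax functor if all $F^{m,n},F^x$ are invertible for $\odot$. $F$ is normal if all $F_x$ are invertible for $\cdot$. Natural transformations. A lax natural transformation $\alpha\colon F\Rightarrow G$ between twisted doubly lax functors $\mathbb D\rightsquigarrow\mathbb E$ consists of arrows $\alpha_x\colon Fx\to Gx$, cells $\alpha_f\colon(\alpha_x\mid Ff\to Gf\mid\alpha_y)$ for $f\colon x\to y$, and naturality comparisons $\alpha_m\colon(\alpha_x\cdot Gm\mid\mathrm{id}_{Fx}\to\mathrm{id}_{Gy}\mid Fm\cdot\alpha_y)$ for $m\colon x\nrightarrow y$, such that: $(\alpha_f\cdot G\gamma)\odot\alpha_n=\alpha_m\odot(F\gamma\cdot\alpha_g)$ for cells $\gamma\colon(f\mid m\to n\mid g)$; $(\alpha_f\odot\alpha_g)\cdot G_{f,g}=F_{f,g}\cdot\alpha_{f\cdot g}$ and $\mathrm{id}_{\alpha_x}\cdot G_x=F_x\cdot\alpha_{1_x}$;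 $(\alpha_m\cdot\mathrm{id}_{Gn})\odot(\mathrm{id}_{Fm}\cdot\alpha_n)\odot(F^{m,n}\cdot\mathrm{id}_{\alpha_z})=(\mathrm{id}_{\alpha_x}\cdot G^{m,n})\odot\alpha_{m\odot n}$ and $F^x\cdot\mathrm{id}_{\alpha_x}=(\mathrm{id}_{\alpha_x}\cdot G^x)\odot\alpha_{\mathrm{id}_x}$. It is pseudo if each $\alpha_m$ is invertible for $\odot$, strict if each $\alpha_m$ is a loose identity. Transformations compose by $(\alpha\cdot\beta)_x=\alpha_x\cdot\beta_x$, $(\alpha\cdot\beta)_f=\alpha_f\cdot\beta_f$, $(\alpha\cdot\beta)_m=(\mathrm{id}_{\alpha_x}\cdot\beta_m)\odot(\alpha_m\cdot\mathrm{id}_{\beta_y})$; invertibility refers to the resulting category. $\mathbf{Prof}$ is the double category of categories, functors (arrows), profunctors $P\colon\mathsf A\nrightarrow\mathsf B$, i.e. functors $\mathsf A^{\mathrm{op}}\times\mathsf B\to\mathbf{Set}$ (proarrows, with coend composition), with cells $(F\mid P\to Q\mid G)$ the natural families $P(a,b)\to Q(Fa,Gb)$. A loosely globular cell $(F\mid\mathrm{id}\to\mathrm{id}\mid G)$ amounts to a natural transformation $F\Rightarrow G$. Elements. $\mathrm{Elt}(T)$ has: objects $(x,a)$ with $x\in\mathbb B$, $a\in Tx$; arrows $(f,\bar f)\colon(x,a)\to(z,c)$ with $f\colon x\to z$, $\bar f\in Tf(a,c)$; proarrows $(m,\bar m)\colon(x,a)\nrightarrow(y,b)$ with $m\colon x\nrightarrow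 y$ and $\bar m\colon Tm(a)\to b$ an isomorphism in $Ty$; cells with left $(f,\bar f)\colon(x,a)\to(z,c)$, right $(g,\bar g)\colon(y,b)\to(w,d)$, top $(m,\bar m)$, bottom $(n,\bar n)$ the cells $\alpha\colon(f\mid m\to n\mid g)$ of $\mathbb B$ with $Tg(1,\bar n)((T\alpha)_{a,c}(\bar f))=Tg(\bar m,1)(\bar g)$. Tight composites are $(f\cdot g,T_{f,g}(\bar f,\bar g))$, tight identities $(1_x,T_x(1_a))$; loose composites $(m\odot n,\overline{m\odot n})$ with $\overline{m\odot n}\colon T(m\odot n)(a)\cong Tn(Tm(a))\xrightarrow{Tn(\bar m)}Tn(b)\xrightarrow{\bar n}c$ using $(T^{m,n})^{-1}$; loose identities $\mathrm{id}_x$ with the inverse of $T^x$; cells compose as in $\mathbb B$. The canonical cleavage of $P_T$ sends $((x,a),m\colon x\nrightarrow y)$ to $(m,1_{Tm(a)})\colon(x,a)\nrightarrow(y,Tm(a))$, and sends a morphism $((f,\bar f),\alpha)$ to the cell $\alpha$ with right arrow $(g,(T\alpha)(\bar f))$. $\mathrm{Tw}(P_T)$ is, concretely: $\mathrm{Tw}(P_T)(x)$ is the category of objects $(x,a)$ of $\mathrm{Elt}(T)$ over $x$ and arrows over $1_x$; $\mathrm{Tw}(P_T)(f)((x,a),(z,c))$ is the set of arrows $(x,a)\to(z,c)$ of $\mathrm{Elt}(T)$ over $f$; $\mathrm{Tw}(P_T)(m)=m_!$ and $\mathrm{Tw}(P_T)(\alpha)=\alpha_!$ are given by the target of the chosen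 lift under the cleavage, so $m_!(x,a)=(y,Tm(a))$ and $\alpha_!(f,\bar f)=(g,(T\alpha)(\bar f))$; tight-to-loose comparisons are composition in $\mathrm{Elt}(T)_0$ and identities; loose-to-tight comparisons have as components the vertical isomorphisms $n_!m_!(x,a)\to(m\odot n)_!(x,a)$ and $(x,a)\to(\mathrm{id}_x)_!(x,a)$ corresponding to the components of $T^{m,n}$ and $T^x$ at $a$ (composed with the comparison $T_z$, resp. $T_x$). *)

(* Defs.v *)
From Stdlib Require Import FunctionalExtensionality PropExtensionality.
From Stdlib Require Import ProofIrrelevance IndefiniteDescription JMeq.
From Stdlib Require Import Relation_Operators.

Set Implicit Arguments.
Unset Strict Implicit.
Set Primitive Projections.

(** * Pseudo double categories *)

(** Tight composition is only propositionally associative and unital, so two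
    cells that the theory calls equal may have frames that are equal without
    being convertible.  [ceq] is equality of cells together with their frames:
    it can only hold when the four sides are (Leibniz) equal. *)
Inductive ceq {H P Q K : Type} {C : H -> P -> Q -> K -> Type}
  {f m n g} (a : C f m n g) :
  forall f' m' n' g', C f' m' n' g' -> Prop :=
  | ceq_refl : ceq a a.
Arguments ceq {H P Q K C f m n g} a {f' m' n' g'} _.
Arguments ceq_refl {H P Q K C f m n g a}.
Notation "a ≡ b" := (ceq a b) (at level 70, no associativity).

Record DblData : Type := {
  dob :> Type;
  arr : dob -> dob -> Type;
  pro : dob -> dob -> Type;
  (* [cell f m n g] is the type of cells (f | m -> n | g) *)
  cell : forall x y z w,
    arr x z -> pro x y -> pro z w -> arr y w -> Type;
  one : forall x, arr x x;
  acomp : forall x y z, arr x y -> arr y z -> arr x z;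
  cone : forall x y (m : pro x y), cell (one x) m m (one y);
  ccomp : forall x y z w u v (f : arr x z) (m : pro x y) (n : pro z w)
    (g : arr y w) (f' : arr z u) (p : pro u v) (g' : arr w v),
    cell f m n g -> cell f' n p g' -> cell (acomp f f') m p (acomp g g');
  lid : forall x, pro x x;
  lcomp : forall x y z, pro x y -> pro y z -> pro x z;
  lidc : forall x y (f : arr x y), cell f (lid x) (lid y) f;
  lcompc : forall x y z u v w (f : arr x u) (g : arr y v) (h : arr z w)
    (m : pro x y) (m' : pro u v) (n : pro y z) (n' : pro v w),
    cell f m m' g -> cell g n n' h -> cell f (lcomp m n) (lcomp m' n') h;
  assoc : forall w x y z (m : pro w x) (n : pro x y) (p : pro y z),
    cell (one w) (lcomp (lcomp m n) p) (lcomp m (lcomp n p)) (one z);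
  assocV : forall w x y z (m : pro w x) (n : pro x y) (p : pro y z),
    cell (one w) (lcomp m (lcomp n p)) (lcomp (lcomp m n) p) (one z);
  lunit : forall x y (m : pro x y), cell (one x) (lcomp (lid x) m) m (one y);
  lunitV : forall x y (m : pro x y), cell (one x) m (lcomp (lid x) m) (one y);
  runit : forall x y (m : pro x y), cell (one x) (lcomp m (lid y)) m (one y);
  runitV : forall x y (m : pro x y), cell (one x) m (lcomp m (lid y)) (one y)
}.

Arguments arr {_} _ _.
Arguments pro {_} _ _.
Arguments cell {_ x y z w} _ _ _ _.
Arguments one {_} _.
Arguments acomp {_ x y z} _ _.
Arguments cone {_ x y} _.
Arguments ccomp {_ x y z w u v f m n g f' p g'} _ _.
Arguments lid {_} _.
Arguments lcomp {_ x y z} _ _.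
Arguments lidc {_ x y} _.
Arguments lcompc {_ x y z u v w f g h m m' n n'} _ _.
Arguments assoc {_ w x y z} _ _ _.
Arguments assocV {_ w x y z} _ _ _.
Arguments lunit {_ x y} _.
Arguments lunitV {_ x y} _.
Arguments runit {_ x y} _.
Arguments runitV {_ x y} _.

(** Tight composites are written [f · g] and [a • b], loose composites
    [m ⊙ n] and [a ⊛ b]; all are in diagrammatic order. *)
Notation "f · g" := (acomp f g) (at level 40, left associativity).
Notation "a • b" := (ccomp a b) (at level 40, left associativity).
Notation "m ⊙ n" := (lcomp m n) (at level 40, left associativity).
Notation "a ⊛ b" := (lcompc a b) (at level 40, left associativity).

Record DblCat : Type := {
  ddata :> DblData;
  acomp1l : forall (x y : ddata) (f : arr x y), one x · f = f;
  acomp1r : forall (x y : ddata) (f : arr x y), f · one y = f;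
  acompA : forall (x y z w : ddata) (f : arr x y) (g : arr y z) (h : arr z w),
    f · g · h = f · (g · h);
  ccomp1l : forall (x y z w : ddata) (f : arr x z) (m : pro x y) (n : pro z w)
    (g : arr y w) (a : cell f m n g), cone m • a ≡ a;
  ccomp1r : forall (x y z w : ddata) (f : arr x z) (m : pro x y) (n : pro z w)
    (g : arr y w) (a : cell f m n g), a • cone n ≡ a;
  ccompA : forall (x y z w u v s t : ddata)
    (f : arr x z) (m : pro x y) (n : pro z w) (g : arr y w)
    (f' : arr z u) (p : pro u v) (g' : arr w v)
    (f'' : arr u s) (q : pro s t) (g'' : arr v t)
    (a : cell f m n g) (b : cell f' n p g') (c : cell f'' p q g''),
    a • b • c ≡ a • (b • c);
  lidc_one : forall x : ddata, lidc (one x) = cone (lid x);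
  lidc_comp : forall (x y z : ddata) (f : arr x y) (g : arr y z),
    lidc (f · g) = lidc f • lidc g;
  lcompc_one : forall (x y z : ddata) (m : pro x y) (n : pro y z),
    cone m ⊛ cone n = cone (m ⊙ n);
  lcompc_comp : forall (x y z u v w r s t : ddata)
    (f : arr x u) (g : arr y v) (h : arr z w)
    (f' : arr u r) (g' : arr v s) (h' : arr w t)
    (m : pro x y) (m' : pro u v) (m'' : pro r s)
    (n : pro y z) (n' : pro v w) (n'' : pro s t)
    (a : cell f m m' g) (a' : cell f' m' m'' g')
    (b : cell g n n' h) (b' : cell g' n' n'' h'),
    (a • a') ⊛ (b • b') = (a ⊛ b) • (a' ⊛ b');
  assocK : forall (w x y z : ddata) (m : pro w x) (n : pro x y) (p : pro y z),
    assoc m n p • assocV m n p ≡ cone (m ⊙ n ⊙ p);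
  assocVK : forall (w x y z : ddata) (m : pro w x) (n : pro x y) (p : pro y z),
    assocV m n p • assoc m n p ≡ cone (m ⊙ (n ⊙ p));
  assoc_nat : forall (w x y z w' x' y' z' : ddata)
    (f : arr w w') (g : arr x x') (h : arr y y') (k : arr z z')
    (m : pro w x) (n : pro x y) (p : pro y z)
    (m' : pro w' x') (n' : pro x' y') (p' : pro y' z')
    (a : cell f m m' g) (b : cell g n n' h) (c : cell h p p' k),
    (a ⊛ b ⊛ c) • assoc m' n' p' ≡ assoc m n p • (a ⊛ (b ⊛ c));
  lunitK : forall (x y : ddata) (m : pro x y),
    lunit m • lunitV m ≡ cone (lid x ⊙ m);
  lunitVK : forall (x y : ddata) (m : pro x y), lunitV m • lunit m ≡ cone m;
  lunit_nat : forall (x y z w : ddata) (f : arr x z) (m : pro x y)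
    (n : pro z w) (g : arr y w) (a : cell f m n g),
    (lidc f ⊛ a) • lunit n ≡ lunit m • a;
  runitK : forall (x y : ddata) (m : pro x y),
    runit m • runitV m ≡ cone (m ⊙ lid y);
  runitVK : forall (x y : ddata) (m : pro x y), runitV m • runit m ≡ cone m;
  runit_nat : forall (x y z w : ddata) (f : arr x z) (m : pro x y)
    (n : pro z w) (g : arr y w) (a : cell f m n g),
    (a ⊛ lidc g) • runit n ≡ runit m • a;
  pentagon : forall (v w x y z : ddata)
    (m : pro v w) (n : pro w x) (p : pro x y) (q : pro y z),
    assoc (m ⊙ n) p q • assoc m n (p ⊙ q)
    ≡ (assoc m n p ⊛ cone q) • assoc m (n ⊙ p) q • (cone m ⊛ assoc n p q);
  triangle : forall (x y z : ddata) (m : pro x y) (n : pro y z),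
    assoc m (lid y) n • (cone m ⊛ lunit n) ≡ runit m ⊛ cone n
}.

Definition castlr {D : DblData} {x y z w : D} {f f' : arr x z} {m : pro x y}
  {n : pro z w} {g g' : arr y w} (ef : f = f') (eg : g = g')
  (a : cell f m n g) : cell f' m n g' :=
  match ef in _ = f0, eg in _ = g0 return cell f0 m n g0 with
  | eq_refl, eq_refl => a
  end.

Section Unitors.
Context {D : DblCat} {x y z w : D}.

Lemma unit_sandwich (f : arr x z) : one x · (f · one z) = f.
Proof. now rewrite acomp1l, acomp1r. Qed.

(** Removal of a loose identity from the top and bottom of a cell: this makes
    explicit the unitors that are elided in equations between cells. *)
Definition unl {f : arr x z} {m : pro x y} {n : pro z w} {g : arr y w}
  (a : cell f (lid x ⊙ m) (lid z ⊙ n) g) : cell f m n g :=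
  @castlr D _ _ _ _ _ _ _ _ _ _ (unit_sandwich f)
    (eq_trans (acomp1l _) (acomp1r g)) (lunitV m • (a • lunit n)).

Definition unr {f : arr x z} {m : pro x y} {n : pro z w} {g : arr y w}
  (a : cell f (m ⊙ lid y) (n ⊙ lid w) g) : cell f m n g :=
  @castlr D _ _ _ _ _ _ _ _ _ _ (unit_sandwich f)
    (eq_trans (acomp1l _) (acomp1r g)) (runitV m • (a • runit n)).
End Unitors.

(** Loose composite of a cell with right arrow [g] and a cell whose left arrow
    is only propositionally equal to [g]. *)
Definition lcompc_cast {D : DblData} {x y z u v w : D}
  {f : arr x u} {g g' : arr y v} {h : arr z w}
  {m : pro x y} {m' : pro u v} {n : pro y z} {n' : pro v w}
  (a : cell f m m' g) (e : g' = g) (b : cell g' n n' h) :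
  cell f (m ⊙ n) (m' ⊙ n') h :=
  a ⊛ castlr e eq_refl b.

Definition tight_invertible {D : DblCat} {x y : D} {m n : pro x y}
  (a : cell (one x) m n (one y)) : Prop :=
  exists b : cell (one x) n m (one y), a • b ≡ cone m /\ b • a ≡ cone n.

Definition loose_invertible {D : DblCat} {x y : D} {f g : arr x y}
  (a : cell f (lid x) (lid y) g) : Prop :=
  exists b : cell g (lid x) (lid y) f,
    unl (a ⊛ b) ≡ lidc f /\ unl (b ⊛ a) ≡ lidc g.

(** * Twisted functors *)

Record TwData (D E : DblCat) : Type := {
  tob :> D -> E;
  tarr : forall x y : D, arr x y -> pro (tob x) (tob y);
  tpro : forall x y : D, pro x y -> arr (tob x) (tob y);
  tcell : forall (x y z w : D) (f : arr x z) (m : pro x y) (n : pro z w)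
    (g : arr y w), cell f m n g -> cell (tpro m) (tarr f) (tarr g) (tpro n);
  (* F_{f,g}, F_x, F^{m,n} and F^x *)
  tcomp : forall (x y z : D) (f : arr x y) (g : arr y z),
    cell (one (tob x)) (tarr f ⊙ tarr g) (tarr (f · g)) (one (tob z));
  tunit : forall x : D,
    cell (one (tob x)) (lid (tob x)) (tarr (one x)) (one (tob x));
  tlcomp : forall (x y z : D) (m : pro x y) (n : pro y z),
    cell (tpro m · tpro n) (lid (tob x)) (lid (tob z)) (tpro (m ⊙ n));
  tlunit : forall x : D,
    cell (one (tob x)) (lid (tob x)) (lid (tob x)) (tpro (lid x))
}.

Arguments tarr {D E} t {x y} _.
Arguments tpro {D E} t {x y} _.
Arguments tcell {D E} t {x y z w f m n g} _.
Arguments tcomp {D E} t {x y z} _ _.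
Arguments tunit {D E} t _.
Arguments tlcomp {D E} t {x y z} _ _.
Arguments tlunit {D E} t _.

(** Twisted doubly lax functors.  Equations whose two sides carry superfluous
    loose identities at the top and bottom are stated after removing these by
    [unl] and [unr]; triple loose composites are bracketed to the right. *)
Record TwFun (D E : DblCat) : Type := {
  tdata :> TwData D E;
  tw_comp_nat : forall (x y z w u v : D)
    (f : arr x z) (m : pro x y) (n : pro z w) (f' : arr y w)
    (g : arr z u) (p : pro u v) (g' : arr w v)
    (a : cell f m n f') (b : cell g n p g'),
    (tcell tdata a ⊛ tcell tdata b) • tcomp tdata f' g'
    ≡ tcomp tdata f g • tcell tdata (a • b);
  tw_unit_nat : forall (x y : D) (m : pro x y),
    lidc (tpro tdata m) • tunit tdata y ≡ tunit tdata x • tcell tdata (cone m);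
  tw_lcomp_nat : forall (x y z u v w : D)
    (f : arr x u) (g : arr y v) (h : arr z w)
    (m : pro x y) (m' : pro u v) (n : pro y z) (n' : pro v w)
    (a : cell f m m' g) (b : cell g n n' h),
    unr ((tcell tdata a • tcell tdata b) ⊛ tlcomp tdata m' n')
    ≡ unl (tlcomp tdata m n ⊛ tcell tdata (a ⊛ b));
  tw_lunit_nat : forall (x y : D) (f : arr x y),
    unr (cone (tarr tdata f) ⊛ tlunit tdata y)
    ≡ unl (tlunit tdata x ⊛ tcell tdata (lidc f));
  tw_comp_assoc : forall (x y z w : D)
    (f : arr x y) (g : arr y z) (h : arr z w),
    (tcomp tdata f g ⊛ cone (tarr tdata h)) • tcomp tdata (f · g) h
    ≡ assoc (tarr tdata f) (tarr tdata g) (tarr tdata h)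
      • ((cone (tarr tdata f) ⊛ tcomp tdata g h) • tcomp tdata f (g · h));
  tw_comp_1l : forall (x y : D) (f : arr x y),
    (tunit tdata x ⊛ cone (tarr tdata f)) • tcomp tdata (one x) f
    ≡ lunit (tarr tdata f);
  tw_comp_1r : forall (x y : D) (f : arr x y),
    (cone (tarr tdata f) ⊛ tunit tdata y) • tcomp tdata f (one y)
    ≡ runit (tarr tdata f);
  tw_lcomp_assoc : forall (w x y z : D)
    (m : pro w x) (n : pro x y) (p : pro y z),
    unl (unl ((tlcomp tdata m n • lidc (tpro tdata p))
      ⊛ lcompc_cast (tlcomp tdata (m ⊙ n) p) (acomp1l _)
          (tunit tdata w • tcell tdata (assoc m n p))))
    ≡ unl (unl ((lidc (tpro tdata m) • tlcomp tdata n p)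
      ⊛ lcompc_cast (tlcomp tdata m (n ⊙ p)) (acomp1r _)
          (lidc (tpro tdata (m ⊙ (n ⊙ p))) • tunit tdata z)));
  tw_lcomp_1l : forall (x y : D) (m : pro x y),
    unl (unl ((tlunit tdata x • lidc (tpro tdata m))
      ⊛ lcompc_cast (tlcomp tdata (lid x) m) (acomp1l _)
          (tunit tdata x • tcell tdata (lunit m))))
    ≡ lidc (tpro tdata m) • tunit tdata y;
  tw_lcomp_1r : forall (x y : D) (m : pro x y),
    unl (unl ((lidc (tpro tdata m) • tlunit tdata y)
      ⊛ lcompc_cast (tlcomp tdata m (lid y)) (acomp1l _)
          (tunit tdata x • tcell tdata (runit m))))
    ≡ lidc (tpro tdata m) • tunit tdata y
}.

Definition is_lax {D E : DblCat} (F : TwFun D E) : Prop :=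
  (forall (x y z : D) (m : pro x y) (n : pro y z),
     loose_invertible (tlcomp F m n))
  /\ (forall x : D, loose_invertible (tlunit F x)).

Definition is_normal {D E : DblCat} (F : TwFun D E) : Prop :=
  forall x : D, tight_invertible (tunit F x).

(** * Lax natural transformations *)

Record NatData {D E : DblCat} (F G : TwFun D E) : Type := {
  nob :> forall x : D, arr (F x) (G x);
  narr : forall (x y : D) (f : arr x y),
    cell (nob x) (tarr F f) (tarr G f) (nob y);
  npro : forall (x y : D) (m : pro x y),
    cell (nob x · tpro G m) (lid (F x)) (lid (G y)) (tpro F m · nob y)
}.

Arguments narr {D E F G} n {x y} _.
Arguments npro {D E F G} n {x y} _.

Record LaxNat {D E : DblCat} (F G : TwFun D E) : Type := {
  ndata :> NatData F G;
  nat_cell : forall (x y z w : D) (f : arr x z) (m : pro x y) (n : pro z w)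
    (g : arr y w) (c : cell f m n g),
    unr ((narr ndata f • tcell G c) ⊛ npro ndata n)
    ≡ unl (npro ndata m ⊛ (tcell F c • narr ndata g));
  nat_comp : forall (x y z : D) (f : arr x y) (g : arr y z),
    (narr ndata f ⊛ narr ndata g) • tcomp G f g
    ≡ tcomp F f g • narr ndata (f · g);
  nat_unit : forall x : D,
    lidc (ndata x) • tunit G x ≡ tunit F x • narr ndata (one x);
  nat_lcomp : forall (x y z : D) (m : pro x y) (n : pro y z),
    unl (unl ((npro ndata m • lidc (tpro G n))
      ⊛ castlr (eq_sym (acompA _ _ _)) eq_refl
          (lcompc_cast (lidc (tpro F m) • npro ndata n) (acompA _ _ _)
             (tlcomp F m n • lidc (ndata z)))))
    ≡ unl ((lidc (ndata x) • tlcomp G m n) ⊛ npro ndata (m ⊙ n));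
  nat_lunit : forall x : D,
    tlunit F x • lidc (ndata x)
    ≡ unl ((lidc (ndata x) • tlunit G x) ⊛ npro ndata (lid x))
}.

Definition is_strict {D E : DblCat} {F G : TwFun D E} (a : NatData F G) : Prop :=
  forall (x y : D) (m : pro x y), npro a m ≡ lidc (a x · tpro G m).

Section NatCategory.
Context {D E : DblCat}.

Definition nat_id (F : TwFun D E) : NatData F F :=
  {| nob := fun x => one (F x);
     narr := fun x y f => cone (tarr F f);
     npro := fun x y m =>
       castlr (eq_sym (acomp1l (tpro F m))) (eq_sym (acomp1r (tpro F m)))
         (lidc (tpro F m)) |}.

Definition nat_vcomp {F G H : TwFun D E} (a : NatData F G) (b : NatData G H) :
  NatData F H :=
  {| nob := fun x => a x · b x;
     narr := fun x y f => narr a f • narr b f;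
     npro := fun x y m =>
       castlr (eq_sym (acompA _ _ _)) (acompA _ _ _)
         (unl (lcompc_cast (lidc (a x) • npro b m) (acompA _ _ _)
                 (npro a m • lidc (b y)))) |}.

Definition nat_eq {F G : TwFun D E} (a b : NatData F G) : Prop :=
  (forall x : D, a x = b x)
  /\ (forall (x y : D) (f : arr x y), narr a f ≡ narr b f)
  /\ (forall (x y : D) (m : pro x y), npro a m ≡ npro b m).

Definition nat_invertible {F G : TwFun D E} (a : LaxNat F G) : Prop :=
  exists b : LaxNat G F,
    nat_eq (nat_vcomp a b) (nat_id F) /\ nat_eq (nat_vcomp b a) (nat_id G).
End NatCategory.

(** * Quotients *)

Definition eqcls {A : Type} (R : A -> A -> Prop) (a : A) : A -> Prop :=
  clos_refl_sym_trans A R a.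

Definition quot {A : Type} (R : A -> A -> Prop) : Type :=
  {S : A -> Prop | exists a, S = eqcls R a}.

Section Quotient.
Context {A : Type} {R : A -> A -> Prop}.

Definition cls (a : A) : quot R := exist _ (eqcls R a) (ex_intro _ a eq_refl).

Definition repr (q : quot R) : A :=
  proj1_sig (constructive_indefinite_description _ (proj2_sig q)).

(** Meaningful only when [f] is invariant under [R], see [qlift_cls]. *)
Definition qlift {B : Type} (f : A -> B) (q : quot R) : B := f (repr q).

Lemma sig_eq {X : Type} {P : X -> Prop} (u v : sig P) :
  proj1_sig u = proj1_sig v -> u = v.
Proof.
  destruct u as [u hu], v as [v hv]; simpl; intros ->.
  now rewrite (proof_irrelevance _ hu hv).
Qed.

Lemma cls_eq (a b : A) : R a b -> cls a = cls b.
Proof.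
  intros h; apply sig_eq; simpl.
  apply functional_extensionality; intros c; apply propositional_extensionality.
  split; intros k.
  - eapply rst_trans; [apply rst_sym, rst_step, h | exact k].
  - eapply rst_trans; [apply rst_step, h | exact k].
Qed.

Lemma cls_repr (q : quot R) : cls (repr q) = q.
Proof.
  apply sig_eq; simpl; unfold repr.
  destruct (constructive_indefinite_description _ (proj2_sig q)) as [a e].
  simpl; symmetry; exact e.
Qed.

Lemma quot_ind (P : quot R -> Prop) : (forall a, P (cls a)) -> forall q, P q.
Proof. intros h q; rewrite <- cls_repr; apply h. Qed.

Lemma qlift_cls {B : Type} (f : A -> B) (a : A) :
  (forall a b, R a b -> f a = f b) -> qlift f (cls a) = f a.
Proof.
  intros h; unfold qlift.
  assert (k : eqcls R (repr (cls a)) a).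
  { assert (e : eqcls R (repr (cls a)) = eqcls R a)
      by exact (f_equal (@proj1_sig _ _) (cls_repr (cls a))).
    rewrite e; apply rst_refl. }
  unfold eqcls in k; induction k; try congruence; auto.
Qed.
End Quotient.

(** * The double category Prof *)

Record Cat : Type := {
  cob :> Type;
  hom : cob -> cob -> Type;
  idm : forall a, hom a a;
  mul : forall a b c, hom a b -> hom b c -> hom a c;
  mul1l : forall a b (u : hom a b), mul (idm a) u = u;
  mul1r : forall a b (u : hom a b), mul u (idm b) = u;
  mulA : forall a b c d (u : hom a b) (v : hom b c) (w : hom c d),
    mul (mul u v) w = mul u (mul v w)
}.
Arguments hom {_} _ _.
Arguments idm {_} _.
Arguments mul {_ a b c} _ _.
Notation "u ∘> v" := (mul u v) (at level 40, left associativity).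

Record Functor (A B : Cat) : Type := {
  fob :> A -> B;
  fmap : forall a b : A, hom a b -> hom (fob a) (fob b);
  fmap1 : forall a : A, fmap (idm a) = idm (fob a);
  fmapM : forall (a b c : A) (u : hom a b) (v : hom b c),
    fmap (u ∘> v) = fmap u ∘> fmap v
}.
Arguments fmap {A B} f {a b} _.

(** Functors A^op × B -> Set *)
Record Profunctor (A B : Cat) : Type := {
  pval :> A -> B -> Type;
  pmap : forall (a a' : A) (b b' : B),
    hom a' a -> hom b b' -> pval a b -> pval a' b';
  pmap1 : forall (a : A) (b : B) (p : pval a b), pmap (idm a) (idm b) p = p;
  pmapM : forall (a a' a'' : A) (b b' b'' : B) (u : hom a' a) (u' : hom a'' a')
    (v : hom b b') (v' : hom b' b'') (p : pval a b),
    pmap (u' ∘> u) (v ∘> v') p = pmap u' v' (pmap u v p)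
}.
Arguments pmap {A B} _ {a a' b b'} _ _ _.

(** Cells (F | P -> Q | G) of Prof *)
Record PCell (A B A' B' : Cat) (F : Functor A A') (P : Profunctor A B)
  (Q : Profunctor A' B') (G : Functor B B') : Type := {
  pcell :> forall (a : A) (b : B), P a b -> Q (F a) (G b);
  pcell_nat : forall (a a' : A) (b b' : B) (u : hom a' a) (v : hom b b')
    (p : P a b), pcell (pmap P u v p) = pmap Q (fmap F u) (fmap G v) (pcell p)
}.
Arguments pcell {A B A' B' F P Q G} _ a b _.

Lemma pmapM' {A B : Cat} (P : Profunctor A B) (a a' a'' : A) (b b' b'' : B)
  (u : hom a' a) (u' : hom a'' a') (v : hom b b') (v' : hom b' b'')
  (p : P a b) : pmap P u' v' (pmap P u v p) = pmap P (u' ∘> u) (v ∘> v') p.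
Proof. symmetry; apply pmapM. Qed.

Definition functor_id (A : Cat) : Functor A A.
Proof.
  refine {| fob := fun a => a; fmap := fun a b u => u |}; reflexivity.
Defined.

Definition functor_comp (A B C : Cat) (F : Functor A B) (G : Functor B C) :
  Functor A C.
Proof.
  refine {| fob := fun a => G (F a); fmap := fun a b u => fmap G (fmap F u) |}.
  - abstract (intros; now rewrite !fmap1).
  - abstract (intros; now rewrite !fmapM).
Defined.

Definition pcell_id (A B : Cat) (P : Profunctor A B) :
  PCell (functor_id A) P P (functor_id B).
Proof.
  now refine {| pcell := fun a b p => p : P (functor_id A a) (functor_id B b) |}.
Defined.

Definition pcell_comp (A B A' B' A'' B'' : Cat)
  (F : Functor A A') (P : Profunctor A B) (Q : Profunctor A' B')
  (G : Functor B B') (F' : Functor A' A'') (R : Profunctor A'' B'')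
  (G' : Functor B' B'') (s : PCell F P Q G) (t : PCell F' Q R G') :
  PCell (functor_comp F F') P R (functor_comp G G').
Proof.
  refine {| pcell := fun a b p =>
              t _ _ (s a b p) : R (functor_comp F F' a) (functor_comp G G' b) |}.
  abstract (intros; now rewrite !pcell_nat).
Defined.

Definition hom_prof (A : Cat) : Profunctor A A.
Proof.
  refine {| pval := fun a b : A => hom a b;
            pmap := fun a a' b b' u v p => u ∘> p ∘> v |}.
  - abstract (intros; now rewrite mul1l, mul1r).
  - abstract (intros; now rewrite !mulA).
Defined.

Definition pcell_lid (A B : Cat) (F : Functor A B) :
  PCell F (hom_prof A) (hom_prof B) F.
Proof.
  refine {| pcell := fun a b (u : hom_prof A a b) =>
                       fmap F u : hom_prof B (F a) (F b) |}.
  abstract (intros; simpl; now rewrite !fmapM).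
Defined.

Section ProfComp.
Context {A B C : Cat}.

Definition pair_el (P : Profunctor A B) (Q : Profunctor B C) (a : A) (c : C) :
  Type := {b : B & (P a b * Q b c)%type}.

Inductive dinat (P : Profunctor A B) (Q : Profunctor B C) (a : A) (c : C) :
  pair_el P Q a c -> pair_el P Q a c -> Prop :=
  | dinat_intro (b b' : B) (v : hom b b') (p : P a b) (q : Q b' c) :
    dinat (existT _ b' (pmap P (idm a) v p, q))
          (existT _ b (p, pmap Q v (idm c) q)).

Definition coend (P : Profunctor A B) (Q : Profunctor B C) (a : A) (c : C) :
  Type := quot (@dinat P Q a c).

Definition tens {P : Profunctor A B} {Q : Profunctor B C} {a : A} {c : C}
  {b : B} (p : P a b) (q : Q b c) : coend P Q a c := cls (existT _ b (p, q)).

Definition coend_lift {P : Profunctor A B} {Q : Profunctor B C} {a : A} {c : C}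
  {X : Type} (f : forall b, P a b -> Q b c -> X) : coend P Q a c -> X :=
  qlift (fun e => f (projT1 e) (fst (projT2 e)) (snd (projT2 e))).

Lemma tens_dinat {P : Profunctor A B} {Q : Profunctor B C} {a : A} {c : C}
  {b b' : B} (v : hom b b') (p : P a b) (q : Q b' c) :
  tens (pmap P (idm a) v p) q = tens p (pmap Q v (idm c) q).
Proof. apply cls_eq; constructor. Qed.

Lemma coend_ind {P : Profunctor A B} {Q : Profunctor B C} {a : A} {c : C}
  (X : coend P Q a c -> Prop) :
  (forall b (p : P a b) (q : Q b c), X (tens p q)) -> forall e, X e.
Proof. intros h; apply quot_ind; intros [b [p q]]; apply h. Qed.

Lemma coend_lift_tens {P : Profunctor A B} {Q : Profunctor B C} {a : A} {c : C}
  {X : Type} (f : forall b, P a b -> Q b c -> X) b (p : P a b) (q : Q b c) :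
  (forall b b' (v : hom b b') (p : P a b) (q : Q b' c),
    f b' (pmap P (idm a) v p) q = f b p (pmap Q v (idm c) q)) ->
  coend_lift f (tens p q) = f b p q.
Proof.
  intros h; unfold coend_lift, tens; rewrite qlift_cls; [reflexivity|].
  intros x y []; apply h.
Qed.

Definition prof_comp_map (P : Profunctor A B) (Q : Profunctor B C)
  (a a' : A) (c c' : C) (u : hom a' a) (v : hom c c') :
  coend P Q a c -> coend P Q a' c' :=
  coend_lift (fun b p q => tens (pmap P u (idm b) p) (pmap Q (idm b) v q)).

Lemma prof_comp_map_tens (P : Profunctor A B) (Q : Profunctor B C)
  (a a' : A) (c c' : C) (u : hom a' a) (v : hom c c') b (p : P a b) (q : Q b c) :
  prof_comp_map u v (tens p q)
  = tens (pmap P u (idm b) p) (pmap Q (idm b) v q).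
Proof.
  unfold prof_comp_map; rewrite coend_lift_tens; [reflexivity|].
  clear; intros b b' w p q.
  rewrite !pmapM', !mul1l, !mul1r.
  transitivity (tens (pmap P (idm a') w (pmap P u (idm b) p))
                     (pmap Q (idm b') v q)).
  - now rewrite pmapM', mul1l, mul1l.
  - rewrite tens_dinat, pmapM'; now rewrite mul1r, mul1r.
Qed.

Definition prof_comp (P : Profunctor A B) (Q : Profunctor B C) :
  Profunctor A C.
Proof.
  refine {| pval := coend P Q;
            pmap := fun a a' c c' u v => @prof_comp_map P Q a a' c c' u v |}.
  - abstract (intros a c; apply coend_ind; intros;
              now rewrite prof_comp_map_tens, !pmap1).
  - abstract (intros; revert p; apply coend_ind; intros;
              now rewrite !prof_comp_map_tens, !pmapM', !mul1l).
Defined.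
End ProfComp.

Lemma tens_pmap {A B C : Cat} (P : Profunctor A B) (Q : Profunctor B C)
  (a a' : A) (c c' : C) (u : hom a' a) (v : hom c c') b (p : P a b) (q : Q b c) :
  pmap (prof_comp P Q) u v (tens p q)
  = tens (pmap P u (idm b) p) (pmap Q (idm b) v q).
Proof. apply prof_comp_map_tens. Qed.

Section ProfCells.

Definition pcell_lcomp_fun (A B C A' B' C' : Cat)
  (F : Functor A A') (G : Functor B B') (H : Functor C C')
  (P : Profunctor A B) (P' : Profunctor A' B')
  (Q : Profunctor B C) (Q' : Profunctor B' C')
  (s : PCell F P P' G) (t : PCell G Q Q' H) (a : A) (c : C) :
  prof_comp P Q a c -> prof_comp P' Q' (F a) (H c) :=
  coend_lift (fun b p q => tens (s a b p) (t b c q)).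

Lemma pcell_lcomp_fun_tens (A B C A' B' C' : Cat)
  (F : Functor A A') (G : Functor B B') (H : Functor C C')
  (P : Profunctor A B) (P' : Profunctor A' B')
  (Q : Profunctor B C) (Q' : Profunctor B' C')
  (s : PCell F P P' G) (t : PCell G Q Q' H) (a : A) (c : C)
  b (p : P a b) (q : Q b c) :
  pcell_lcomp_fun s t (tens p q) = tens (s a b p) (t b c q).
Proof.
  unfold pcell_lcomp_fun; rewrite coend_lift_tens; [reflexivity|].
  clear; intros b b' v p q; rewrite !pcell_nat, !fmap1; apply tens_dinat.
Qed.

Definition pcell_lcomp (A B C A' B' C' : Cat)
  (F : Functor A A') (G : Functor B B') (H : Functor C C')
  (P : Profunctor A B) (P' : Profunctor A' B')
  (Q : Profunctor B C) (Q' : Profunctor B' C')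
  (s : PCell F P P' G) (t : PCell G Q Q' H) :
  PCell F (prof_comp P Q) (prof_comp P' Q') H.
Proof.
  refine {| pcell := fun a c => @pcell_lcomp_fun _ _ _ _ _ _ F G H P P' Q Q' s t a c |}.
  abstract (intros; revert p; apply coend_ind; intros;
    rewrite tens_pmap, !pcell_lcomp_fun_tens, tens_pmap, !pcell_nat, !fmap1;
    reflexivity).
Defined.

Context {A B C D : Cat}.

Definition pcell_assoc_fun (P : Profunctor A B) (Q : Profunctor B C)
  (R : Profunctor C D) (a : A) (d : D) :
  prof_comp (prof_comp P Q) R a d -> prof_comp P (prof_comp Q R) a d :=
  coend_lift (fun c (e : prof_comp P Q a c) (r : R c d) =>
    coend_lift (fun b (p : P a b) (q : Q b c) =>
      tens p (tens q r : prof_comp Q R b d)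
      : prof_comp P (prof_comp Q R) a d) e).

Lemma pcell_assoc_tens (P : Profunctor A B) (Q : Profunctor B C)
  (R : Profunctor C D) (a : A) (d : D) b c (p : P a b) (q : Q b c) (r : R c d) :
  pcell_assoc_fun (tens (tens p q : prof_comp P Q a c) r)
  = tens p (tens q r : prof_comp Q R b d).
Proof.
  assert (h : forall a c d b (p : P a b) (q : Q b c) (r : R c d),
    coend_lift (fun b (p : P a b) (q : Q b c) =>
      tens p (tens q r : prof_comp Q R b d)
      : prof_comp P (prof_comp Q R) a d) (tens p q)
    = tens p (tens q r : prof_comp Q R b d)).
  { clear; intros; rewrite coend_lift_tens; [reflexivity|].
    clear p q; intros b0 b' v p q.
    rewrite tens_dinat, tens_pmap, pmap1; reflexivity. }
  unfold pcell_assoc_fun; rewrite coend_lift_tens; [apply h|].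
  clear - h; intros c c' v e r; revert e; apply coend_ind; intros b p q.
  rewrite tens_pmap, !h, pmap1; now rewrite tens_dinat.
Qed.

Definition pcell_assocV_fun (P : Profunctor A B) (Q : Profunctor B C)
  (R : Profunctor C D) (a : A) (d : D) :
  prof_comp P (prof_comp Q R) a d -> prof_comp (prof_comp P Q) R a d :=
  coend_lift (fun b p (e : prof_comp Q R b d) =>
    coend_lift (fun c (q : Q b c) (r : R c d) =>
      tens (tens p q : prof_comp P Q a c) r
      : prof_comp (prof_comp P Q) R a d) e).

Lemma pcell_assocV_tens (P : Profunctor A B) (Q : Profunctor B C)
  (R : Profunctor C D) (a : A) (d : D) b c (p : P a b) (q : Q b c) (r : R c d) :
  pcell_assocV_fun (tens p (tens q r : prof_comp Q R b d))
  = tens (tens p q : prof_comp P Q a c) r.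
Proof.
  assert (h : forall a d b c (p : P a b) (q : Q b c) (r : R c d),
    coend_lift (fun c (q : Q b c) (r : R c d) =>
      tens (tens p q : prof_comp P Q a c) r
      : prof_comp (prof_comp P Q) R a d) (tens q r)
    = tens (tens p q : prof_comp P Q a c) r).
  { clear; intros; rewrite coend_lift_tens; [reflexivity|].
    clear q r; intros c0 c' v q r.
    rewrite <- tens_dinat, tens_pmap, pmap1; reflexivity. }
  unfold pcell_assocV_fun; rewrite coend_lift_tens; [apply h|].
  clear - h; intros b b' v p e; revert e; apply coend_ind; intros c q r.
  rewrite tens_pmap, !h, pmap1; now rewrite tens_dinat.
Qed.

Definition pcell_assoc (P : Profunctor A B) (Q : Profunctor B C)
  (R : Profunctor C D) :
  PCell (functor_id A) (prof_comp (prof_comp P Q) R)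
    (prof_comp P (prof_comp Q R)) (functor_id D).
Proof.
  refine {| pcell := @pcell_assoc_fun P Q R
     : (forall a d, _ -> prof_comp P (prof_comp Q R) (functor_id A a) (functor_id D d)) |}.
  abstract (intros; revert p; apply coend_ind; intros y e r; revert e;
    apply coend_ind; intros x p q;
    now rewrite !tens_pmap, !pcell_assoc_tens, !tens_pmap).
Defined.

Definition pcell_assocV (P : Profunctor A B) (Q : Profunctor B C)
  (R : Profunctor C D) :
  PCell (functor_id A) (prof_comp P (prof_comp Q R))
    (prof_comp (prof_comp P Q) R) (functor_id D).
Proof.
  refine {| pcell := @pcell_assocV_fun P Q R
     : (forall a d, _ -> prof_comp (prof_comp P Q) R (functor_id A a) (functor_id D d)) |}.
  abstract (intros; revert p; apply coend_ind; intros x p e; revert e;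
    apply coend_ind; intros y q r;
    now rewrite !tens_pmap, !pcell_assocV_tens, !tens_pmap).
Defined.

Definition pcell_lunit_fun (P : Profunctor A B) (a : A) (b : B) :
  prof_comp (hom_prof A) P a b -> P a b :=
  coend_lift (P := hom_prof A) (fun a' (u : hom a a') p => pmap P u (idm b) p).

Lemma pcell_lunit_tens (P : Profunctor A B) (a : A) (b : B) (a' : A)
  (u : hom a a') (p : P a' b) :
  pcell_lunit_fun (tens (u : hom_prof A a a') p) = pmap P u (idm b) p.
Proof.
  unfold pcell_lunit_fun; rewrite coend_lift_tens; [reflexivity|].
  clear; intros c c' v u p; simpl.
  now rewrite pmapM', !mul1l.
Qed.

Definition pcell_runit_fun (P : Profunctor A B) (a : A) (b : B) :
  prof_comp P (hom_prof B) a b -> P a b :=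
  coend_lift (Q := hom_prof B) (fun b' p (v : hom b' b) => pmap P (idm a) v p).

Lemma pcell_runit_tens (P : Profunctor A B) (a : A) (b b' : B)
  (p : P a b') (v : hom b' b) :
  pcell_runit_fun (tens p (v : hom_prof B b' b)) = pmap P (idm a) v p.
Proof.
  unfold pcell_runit_fun; rewrite coend_lift_tens; [reflexivity|].
  clear; intros c c' v p w; simpl.
  now rewrite pmapM', !mul1l, mul1r.
Qed.

Definition pcell_lunit (P : Profunctor A B) :
  PCell (functor_id A) (prof_comp (hom_prof A) P) P (functor_id B).
Proof.
  refine {| pcell := @pcell_lunit_fun P
     : (forall a b, _ -> P (functor_id A a) (functor_id B b)) |}.
  abstract (intros; revert p; apply coend_ind; intros c w p;
    rewrite tens_pmap, !pcell_lunit_tens; simpl;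
    now rewrite !pmapM', !mul1l, !mul1r).
Defined.

Definition pcell_runit (P : Profunctor A B) :
  PCell (functor_id A) (prof_comp P (hom_prof B)) P (functor_id B).
Proof.
  refine {| pcell := @pcell_runit_fun P
     : (forall a b, _ -> P (functor_id A a) (functor_id B b)) |}.
  abstract (intros; revert p; apply coend_ind; intros c p w;
    rewrite tens_pmap, !pcell_runit_tens; simpl;
    now rewrite !pmapM', !mul1l, !mul1r).
Defined.

Definition pcell_lunitV (P : Profunctor A B) :
  PCell (functor_id A) P (prof_comp (hom_prof A) P) (functor_id B).
Proof.
  refine {| pcell := fun a b p => tens (idm a : hom_prof A a a) p
     : prof_comp (hom_prof A) P (functor_id A a) (functor_id B b) |}.
  abstract (intros; simpl fmap; rewrite tens_pmap; simpl;
    rewrite !mul1r;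
    transitivity (tens (pmap (hom_prof A) (idm a') u (idm a') : hom_prof A a' a)
                       (pmap P (idm a) v p));
    [rewrite tens_dinat, pmapM'; now rewrite !mul1r
    |simpl; now rewrite !mul1l]).
Defined.

Definition pcell_runitV (P : Profunctor A B) :
  PCell (functor_id A) P (prof_comp P (hom_prof B)) (functor_id B).
Proof.
  refine {| pcell := fun a b p => tens p (idm b : hom_prof B b b)
     : prof_comp P (hom_prof B) (functor_id A a) (functor_id B b) |}.
  abstract (intros; simpl fmap; rewrite tens_pmap; simpl;
    rewrite !mul1l;
    transitivity (tens (pmap P u (idm b) p)
                  (pmap (hom_prof B) v (idm b') (idm b') : hom_prof B b b'));
    [rewrite <- tens_dinat, pmapM'; now rewrite !mul1l
    |simpl; now rewrite !mul1r]).
Defined.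
End ProfCells.

Section ProfEq.
Context {A B A' B' : Cat}.

Lemma pcell_ext {F : Functor A A'} {P : Profunctor A B} {Q : Profunctor A' B'}
  {G : Functor B B'} (s t : PCell F P Q G) :
  (forall a b p, s a b p = t a b p) -> s = t.
Proof.
  intros h; destruct s as [s hs], t as [t ht]; simpl in h.
  assert (s = t) as ->.
  { do 3 (apply functional_extensionality_dep; intro); apply h. }
  now rewrite (proof_irrelevance _ hs ht).
Qed.

Lemma prof_ceq_gen {F F' : Functor A A'} {P : Profunctor A B}
  {Q Q' : Profunctor A' B'} {G G' : Functor B B'}
  (s : PCell F P Q G) (t : PCell F' P Q' G') :
  F = F' -> G = G' -> Q = Q' ->
  (forall a b p, JMeq (s a b p) (t a b p)) -> ceq (C := @PCell A B A' B') s t.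
Proof.
  intros -> -> -> h; assert (s = t) as ->; [|constructor].
  apply pcell_ext; intros; now apply JMeq_eq.
Qed.

Lemma prof_ceq_elim {F F' : Functor A A'} {P P' : Profunctor A B}
  {Q Q' : Profunctor A' B'} {G G' : Functor B B'}
  {s : PCell F P Q G} {t : PCell F' P' Q' G'} :
  ceq (C := @PCell A B A' B') s t ->
  forall a b p p', JMeq p p' -> JMeq (s a b p) (t a b p').
Proof. intros []; intros a b p p' e; now rewrite (JMeq_eq e). Qed.
End ProfEq.

Lemma eq_JM {A : Type} (x y : A) : x = y -> JMeq x y.
Proof. now intros ->. Qed.

Lemma functor_irrel {A B : Cat} {o : A -> B}
  {m : forall a b : A, hom a b -> hom (o a) (o b)}
  (p p' : forall a, m a a (idm a) = idm (o a))
  (q q' : forall (a b c : A) (u : hom a b) (v : hom b c),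
     m a c (u ∘> v) = m a b u ∘> m b c v) :
  {| fob := o; fmap := m; fmap1 := p; fmapM := q |}
  = {| fob := o; fmap := m; fmap1 := p'; fmapM := q' |}.
Proof.
  now rewrite (proof_irrelevance _ p p'), (proof_irrelevance _ q q').
Qed.

Ltac functor_conv :=
  match goal with |- ?F = ?G =>
    exact (functor_irrel (fmap1 F) (fmap1 G) (fmapM F) (fmapM G)) end.

Definition ProfData : DblData := {|
  dob := Cat;
  arr := Functor;
  pro := Profunctor;
  cell := @PCell;
  one := functor_id;
  acomp := functor_comp;
  cone := pcell_id;
  ccomp := fun x y z w u v f m n g f' p g' => @pcell_comp x y z w u v f m n g f' p g';
  lid := hom_prof;
  lcomp := @prof_comp;
  lidc := pcell_lid;
  lcompc := fun x y z u v w f g h m m' n n' => @pcell_lcomp x y z u v w f g h m m' n n';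
  assoc := @pcell_assoc;
  assocV := @pcell_assocV;
  lunit := @pcell_lunit;
  lunitV := @pcell_lunitV;
  runit := @pcell_runit;
  runitV := @pcell_runitV
|}.


Ltac prof_ceq := apply prof_ceq_gen; [functor_conv | functor_conv | reflexivity |].

Ltac prof_elim :=
  repeat match goal with
  | |- forall p : coend _ _ _ _, _ => apply coend_ind; intros ? ? ?
  | |- forall p : pval (prof_comp _ _) _ _, _ => apply coend_ind; intros ? ? ?
  | p : pval (prof_comp _ _) _ _ |- _ => revert p
  | p : coend _ _ _ _ |- _ => revert p
  end.

Ltac prof_simp :=
  simpl; rewrite ?pcell_lcomp_fun_tens; simpl;
  repeat (rewrite ?pcell_lcomp_fun_tens, ?pcell_assoc_tens, ?pcell_assocV_tens,
    ?pcell_lunit_tens, ?pcell_runit_tens; simpl).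

Definition Prof : DblCat.
Proof.
  refine {| ddata := ProfData |}; unfold ProfData; cbn -[coend].
  1-3: abstract (intros; functor_conv).
  1-3: abstract (intros; prof_ceq; reflexivity).
  - abstract (intros; apply pcell_ext; reflexivity).
  - abstract (intros; apply pcell_ext; reflexivity).
  - abstract (intros; apply pcell_ext; intros; prof_elim; now prof_simp).
  - abstract (intros; apply pcell_ext; intros; prof_elim; now prof_simp).
  - abstract (intros; prof_ceq; intros; apply eq_JM; prof_elim; now prof_simp).
  - abstract (intros; prof_ceq; intros; apply eq_JM; prof_elim; now prof_simp).
  - abstract (intros; prof_ceq; intros; apply eq_JM; prof_elim; now prof_simp).
  - abstract (intros; prof_ceq; intros; apply eq_JM; prof_elim; prof_simp;
      rewrite <- tens_dinat; simpl; now rewrite !mul1l).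
  - abstract (intros; prof_ceq; intros; apply eq_JM; prof_elim; prof_simp;
      apply pmap1).
  - abstract (intros; prof_ceq; intros; apply eq_JM; prof_elim; prof_simp;
      now rewrite pcell_nat, fmap1).
  - abstract (intros; prof_ceq; intros; apply eq_JM; prof_elim; prof_simp;
      rewrite tens_dinat; simpl; now rewrite !mul1r).
  - abstract (intros; prof_ceq; intros; apply eq_JM; prof_elim; prof_simp;
      apply pmap1).
  - abstract (intros; prof_ceq; intros; apply eq_JM; prof_elim; prof_simp;
      now rewrite pcell_nat, fmap1).
  - abstract (intros; prof_ceq; intros; apply eq_JM; prof_elim; prof_simp;
      reflexivity).
  - abstract (intros; prof_ceq; intros; apply eq_JM; prof_elim; prof_simp;
      now rewrite tens_dinat).
Defined.

(** * Twisted functors into Prof, elementwise *)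

Section Eval.
Context {A B A' B' : Prof}.

Lemma castlr_eval {F F' : arr A A'} {P : pro A B} {Q : pro A' B'}
  {G G' : arr B B'} (eF : F = F') (eG : G = G') (s : cell F P Q G)
  (a : cob A) (b : cob B) (p : pval P a b) :
  JMeq (pcell (castlr eF eG s) a b p) (pcell s a b p).
Proof. destruct eF, eG; constructor. Qed.

Lemma unl_eval {F : arr A A'} {P : pro A B} {Q : pro A' B'} {G : arr B B'}
  (s : cell F (lid A ⊙ P) (lid A' ⊙ Q) G) (a : cob A) (b : cob B)
  (p : pval P a b) :
  pcell (unl s) a b p
  = pcell_lunit_fun (pcell s a b (tens (P := hom_prof A) (Q := P) (idm a) p)).
Proof. apply JMeq_eq; exact (castlr_eval _ _ _ p). Qed.

Lemma unr_eval {F : arr A A'} {P : pro A B} {Q : pro A' B'} {G : arr B B'}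
  (s : cell F (P ⊙ lid B) (Q ⊙ lid B') G) (a : cob A) (b : cob B)
  (p : pval P a b) :
  pcell (unr s) a b p
  = pcell_runit_fun (pcell s a b (tens (P := P) (Q := hom_prof B) p (idm b))).
Proof. apply JMeq_eq; exact (castlr_eval _ _ _ p). Qed.

Lemma unl_lcompc {F G : arr A A'} {P : pro A B} {Q : pro A' B'} {H : arr B B'}
  (s : cell F (lid A) (lid A') G) (t : cell G P Q H) (a : cob A) (b : cob B)
  (p : pval P a b) :
  pcell (unl (s ⊛ t)) a b p
  = pmap Q (pcell s a a (idm a)) (idm _) (pcell t a b p).
Proof.
  rewrite unl_eval; etransitivity;
    [apply f_equal; exact (pcell_lcomp_fun_tens s t (idm a) p)|].
  apply pcell_lunit_tens.
Qed.

Lemma unr_lcompc {F : arr A A'} {P : pro A B} {Q : pro A' B'} {G H : arr B B'}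
  (s : cell F P Q G) (t : cell G (lid B) (lid B') H) (a : cob A) (b : cob B)
  (p : pval P a b) :
  pcell (unr (s ⊛ t)) a b p
  = pmap Q (idm _) (pcell t b b (idm b)) (pcell s a b p).
Proof.
  rewrite unr_eval; etransitivity;
    [apply f_equal; exact (pcell_lcomp_fun_tens s t p (idm b))|].
  apply pcell_runit_tens.
Qed.

Lemma unl_unl_lcompc {F G H : arr A A'} {P : pro A B} {Q : pro A' B'}
  {K : arr B B'} (s : cell F (lid A) (lid A') G) (t : cell G (lid A) (lid A') H)
  (r : cell H P Q K) (a : cob A) (b : cob B) (p : pval P a b) :
  pcell (unl (unl (s ⊛ (t ⊛ r)))) a b p
  = pmap Q ((pcell s a a (idm a) : hom (fob F a) (fob G a))
            ∘> (pcell t a a (idm a) : hom (fob G a) (fob H a)))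
      (idm _) (pcell r a b p).
Proof.
  rewrite unl_eval, unl_lcompc; etransitivity;
    [do 2 apply f_equal; exact (pcell_lcomp_fun_tens t r (idm a) p)|].
  etransitivity; [apply f_equal; apply tens_pmap|].
  etransitivity; [apply pcell_lunit_tens|].
  simpl; now rewrite pmapM', !mul1r.
Qed.
End Eval.

Section Elementwise.
Context {B : DblCat} (T : TwFun B Prof).

Definition el_cat (x : B) : Cat := T x.
Definition el_fun {x y : B} (m : pro x y) : Functor (el_cat x) (el_cat y) :=
  tpro T m.
Definition el_prof {x y : B} (f : arr x y) :
  Profunctor (el_cat x) (el_cat y) := tarr T f.

Definition el_act {x y z w : B} {f : arr x z} {m : pro x y} {n : pro z w}
  {g : arr y w} (s : cell f m n g) {a : el_cat x} {c : el_cat z}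
  (u : el_prof f a c) : el_prof g (el_fun m a) (el_fun n c) :=
  pcell (tcell T s) a c u.

Definition el_comp {x y z : B} {f : arr x y} {g : arr y z} {a : el_cat x}
  {b : el_cat y} {c : el_cat z} (u : el_prof f a b) (v : el_prof g b c) :
  el_prof (f · g) a c :=
  pcell (tcomp T f g) a c (tens u v).

Definition el_unit {x : B} {a b : el_cat x} (u : hom a b) :
  el_prof (one x) a b :=
  pcell (tunit T x) a b u.

(** Components of the natural transformations corresponding to T^{m,n}, T^x *)
Definition el_lcomp {x y z : B} (m : pro x y) (n : pro y z) (a : el_cat x) :
  hom (el_fun n (el_fun m a)) (el_fun (m ⊙ n) a) :=
  pcell (tlcomp T m n) a a (idm a).

Definition el_lunit (x : B) (a : el_cat x) : hom a (el_fun (lid x) a) :=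
  pcell (tlunit T x) a a (idm a).
Arguments el_lunit x a : clear implicits.

Lemma el_act_ceq {x y z w : B} {f f' : arr x z} {m m' : pro x y}
  {n n' : pro z w} {g g' : arr y w} {s : cell f m n g} {s' : cell f' m' n' g'}
  {a : el_cat x} {c : el_cat z} (u : el_prof f a c) (u' : el_prof f' a c) :
  s ≡ s' -> JMeq u u' -> JMeq (el_act s u) (el_act s' u').
Proof.
  intros e; revert u'; destruct e; intros u' h; now rewrite (JMeq_eq h).
Qed.

Lemma el_act_comp {x y z w u v : B} {f : arr x z} {m : pro x y} {n : pro z w}
  {f' : arr y w} {g : arr z u} {p : pro u v} {g' : arr w v}
  (s : cell f m n f') (t : cell g n p g') {a b c}
  (h : el_prof f a b) (k : el_prof g b c) :
  el_act (s • t) (el_comp h k) = el_comp (el_act s h) (el_act t k).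
Proof.
  symmetry; apply JMeq_eq.
  pose proof (prof_ceq_elim (tw_comp_nat T s t) (a := a) (b := c)
    (p := tens h k) JMeq_refl) as e.
  cbn in e; rewrite pcell_lcomp_fun_tens in e; exact e.
Qed.
Lemma el_act_nat {x y z w : B} {f : arr x z} {m : pro x y} {n : pro z w}
  {g : arr y w} (s : cell f m n g) {a a' : el_cat x} {c c' : el_cat z}
  (u : hom a' a) (v : hom c c') (h : el_prof f a c) :
  el_act s (pmap (el_prof f) u v h)
  = pmap (el_prof g) (fmap (el_fun m) u) (fmap (el_fun n) v) (el_act s h).
Proof. exact (pcell_nat (tcell T s) u v h). Qed.

Lemma el_comp_nat {x y z : B} {f : arr x y} {g : arr y z} {a a' : el_cat x}
  {b : el_cat y} {c c' : el_cat z} (u : hom a' a) (v : hom c c')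
  (h : el_prof f a b) (k : el_prof g b c) :
  pmap (el_prof (f · g)) u v (el_comp h k)
  = el_comp (pmap (el_prof f) u (idm b) h) (pmap (el_prof g) (idm b) v k).
Proof.
  symmetry; etransitivity;
    [|exact (pcell_nat (tcomp T f g) u v (tens h k))].
  unfold el_comp; f_equal; symmetry; apply tens_pmap.
Qed.

Lemma el_comp_dinat {x y z : B} {f : arr x y} {g : arr y z} {a : el_cat x}
  {b b' : el_cat y} {c : el_cat z} (v : hom b b')
  (h : el_prof f a b) (k : el_prof g b' c) :
  el_comp (pmap (el_prof f) (idm a) v h) k
  = el_comp h (pmap (el_prof g) v (idm c) k).
Proof. unfold el_comp; f_equal; apply tens_dinat. Qed.

Lemma el_unit_nat {x : B} {a a' b b' : el_cat x} (u : hom a' a) (v : hom b b')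
  (h : hom a b) :
  el_unit (u ∘> h ∘> v) = pmap (el_prof (one x)) u v (el_unit h).
Proof. exact (pcell_nat (tunit T x) u v h). Qed.

Lemma el_unit_l {x : B} {a b c : el_cat x} (u : hom a b) (v : hom b c) :
  pmap (el_prof (one x)) u (idm c) (el_unit v) = el_unit (u ∘> v).
Proof. now rewrite <- el_unit_nat, mul1r. Qed.

Lemma el_unit_r {x : B} {a b c : el_cat x} (u : hom a b) (v : hom b c) :
  pmap (el_prof (one x)) (idm a) v (el_unit u) = el_unit (u ∘> v).
Proof. now rewrite <- el_unit_nat, mul1l. Qed.

Lemma el_act_unit {x y : B} (m : pro x y) {a b : el_cat x} (u : hom a b) :
  el_act (cone m) (el_unit u) = el_unit (fmap (el_fun m) u).
Proof.
  symmetry; apply JMeq_eq.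
  exact (prof_ceq_elim (tw_unit_nat T m) (a := a) (b := b) (p := u) JMeq_refl).
Qed.

Lemma el_comp_assoc {x y z w : B} {f : arr x y} {g : arr y z} {h : arr z w}
  {a b c d} (u : el_prof f a b) (v : el_prof g b c) (t : el_prof h c d) :
  JMeq (el_comp (el_comp u v) t) (el_comp u (el_comp v t)).
Proof.
  pose proof (prof_ceq_elim (tw_comp_assoc T f g h) (a := a) (b := d)
    (p := tens (tens u v : prof_comp (tarr T f) (tarr T g) a c) t)
    JMeq_refl) as e.
  cbn in e.
  rewrite pcell_lcomp_fun_tens, pcell_assoc_tens, pcell_lcomp_fun_tens in e.
  exact e.
Qed.

Lemma el_comp_unitl {x y : B} {f : arr x y} {a b c} (u : hom a b)
  (v : el_prof f b c) :
  JMeq (el_comp (el_unit u) v) (pmap (el_prof f) u (idm c) v).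
Proof.
  pose proof (prof_ceq_elim (tw_comp_1l T f) (a := a) (b := c)
    (p := tens (P := hom_prof (el_cat x)) (Q := tarr T f) u v) JMeq_refl) as e.
  cbn in e; rewrite pcell_lcomp_fun_tens, pcell_lunit_tens in e; exact e.
Qed.

Lemma el_comp_unitr {x y : B} {f : arr x y} {a b c} (u : el_prof f a b)
  (v : hom b c) :
  JMeq (el_comp u (el_unit v)) (pmap (el_prof f) (idm a) v u).
Proof.
  pose proof (prof_ceq_elim (tw_comp_1r T f) (a := a) (b := c)
    (p := tens (P := tarr T f) (Q := hom_prof (el_cat y)) u v) JMeq_refl) as e.
  cbn in e; rewrite pcell_lcomp_fun_tens, pcell_runit_tens in e; exact e.
Qed.

Lemma el_lcomp_cell {x y z : B} (m : pro x y) (n : pro y z) {a b : el_cat x}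
  (u : hom a b) :
  pcell (tlcomp T m n) a b u
  = fmap (el_fun n) (fmap (el_fun m) u) ∘> el_lcomp m n b.
Proof.
  transitivity (pcell (tlcomp T m n) a b
    (pmap (hom_prof (el_cat x)) u (idm b) (idm b))).
  - simpl; now rewrite mul1r, mul1r.
  - etransitivity; [exact (pcell_nat (tlcomp T m n) u (idm b) (idm b))|].
    simpl; rewrite fmap1; apply mul1r.
Qed.

Lemma el_lcomp_cell' {x y z : B} (m : pro x y) (n : pro y z) {a b : el_cat x}
  (u : hom a b) :
  pcell (tlcomp T m n) a b u = el_lcomp m n a ∘> fmap (el_fun (m ⊙ n)) u.
Proof.
  transitivity (pcell (tlcomp T m n) a b
    (pmap (hom_prof (el_cat x)) (idm a) u (idm a))).
  - simpl; now rewrite mul1l, mul1l.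
  - etransitivity; [exact (pcell_nat (tlcomp T m n) (idm a) u (idm a))|].
    simpl; rewrite !fmap1; now rewrite mul1l.
Qed.

Lemma el_lcomp_nat {x y z : B} (m : pro x y) (n : pro y z) {a b : el_cat x}
  (u : hom a b) :
  fmap (el_fun n) (fmap (el_fun m) u) ∘> el_lcomp m n b
  = el_lcomp m n a ∘> fmap (el_fun (m ⊙ n)) u.
Proof. now rewrite <- el_lcomp_cell, el_lcomp_cell'. Qed.

Lemma el_lunit_cell {x : B} {a b : el_cat x} (u : hom a b) :
  pcell (tlunit T x) a b u = u ∘> el_lunit x b.
Proof.
  transitivity (pcell (tlunit T x) a b
    (pmap (hom_prof (el_cat x)) u (idm b) (idm b))).
  - simpl; now rewrite mul1r, mul1r.
  - etransitivity; [exact (pcell_nat (tlunit T x) u (idm b) (idm b))|].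
    simpl; rewrite fmap1; apply mul1r.
Qed.

Lemma el_lunit_cell' {x : B} {a b : el_cat x} (u : hom a b) :
  pcell (tlunit T x) a b u = el_lunit x a ∘> fmap (el_fun (lid x)) u.
Proof.
  transitivity (pcell (tlunit T x) a b
    (pmap (hom_prof (el_cat x)) (idm a) u (idm a))).
  - simpl; now rewrite mul1l, mul1l.
  - etransitivity; [exact (pcell_nat (tlunit T x) (idm a) u (idm a))|].
    simpl; now rewrite mul1l.
Qed.

Lemma el_lunit_nat {x : B} {a b : el_cat x} (u : hom a b) :
  u ∘> el_lunit x b = el_lunit x a ∘> fmap (el_fun (lid x)) u.
Proof. now rewrite <- el_lunit_cell, el_lunit_cell'. Qed.

Lemma el_act_lcomp {x y z u v w : B} {f : arr x u} {g : arr y v} {h : arr z w}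
  {m : pro x y} {m' : pro u v} {n : pro y z} {n' : pro v w}
  (s : cell f m m' g) (t : cell g n n' h) {a c} (k : el_prof f a c) :
  pmap (el_prof h) (idm _) (el_lcomp m' n' c) (el_act t (el_act s k))
  = pmap (el_prof h) (el_lcomp m n a) (idm _) (el_act (s ⊛ t) k).
Proof.
  pose proof (prof_ceq_elim (tw_lcomp_nat T s t) (a := a) (b := c)
    (p := k) JMeq_refl) as e.
  apply JMeq_eq in e; rewrite unr_lcompc, unl_lcompc in e; exact e.
Qed.

Lemma el_act_lid {x y : B} {f : arr x y} {a c} (k : el_prof f a c) :
  pmap (el_prof f) (idm _) (el_lunit y c) k
  = pmap (el_prof f) (el_lunit x a) (idm _) (el_act (lidc f) k).
Proof.
  pose proof (prof_ceq_elim (tw_lunit_nat T f) (a := a) (b := c)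
    (p := k) JMeq_refl) as e.
  apply JMeq_eq in e; rewrite unr_lcompc, unl_lcompc in e; exact e.
Qed.

Lemma el_lcomp_assoc {w x y z : B} (m : pro w x) (n : pro x y) (p : pro y z)
  (a : el_cat w) :
  pmap (el_prof (one z)) (fmap (el_fun p) (el_lcomp m n a)
      ∘> el_lcomp (m ⊙ n) p a) (idm _) (el_act (assoc m n p) (el_unit (idm a)))
  = el_unit (el_lcomp n p (el_fun m a) ∘> el_lcomp m (n ⊙ p) a).
Proof.
  pose proof (prof_ceq_elim (tw_lcomp_assoc T m n p) (a := a) (b := a)
    (p := idm a) JMeq_refl) as e.
  apply JMeq_eq in e; unfold lcompc_cast in e; rewrite !unl_unl_lcompc in e.
  pose proof (JMeq_eq (castlr_eval (acomp1l _) eq_refl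
    (tunit T w • tcell T (assoc m n p)) (idm a))
    : _ = el_act (assoc m n p) (el_unit (idm a))) as e1.
  pose proof (JMeq_eq (castlr_eval (acomp1r _) eq_refl
    (lidc (tpro T (m ⊙ (n ⊙ p))) • tunit T z) (idm a))
    : _ = el_unit (fmap (el_fun (m ⊙ (n ⊙ p))) (idm a))) as e2.
  rewrite e1, e2, fmap1 in e.
  etransitivity; [exact e|].
  etransitivity; [apply el_unit_l|].
  rewrite mul1r; unfold el_lcomp; cbn; now rewrite fmap1.
Qed.

Lemma el_lcomp_unitl {x y : B} (m : pro x y) (a : el_cat x) :
  pmap (el_prof (one y)) (fmap (el_fun m) (el_lunit x a)
      ∘> el_lcomp (lid x) m a) (idm _) (el_act (lunit m) (el_unit (idm a)))
  = el_unit (idm (el_fun m a)).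
Proof.
  pose proof (prof_ceq_elim (tw_lcomp_1l T m) (a := a) (b := a)
    (p := idm a) JMeq_refl) as e.
  apply JMeq_eq in e; unfold lcompc_cast in e; rewrite !unl_unl_lcompc in e.
  pose proof (JMeq_eq (castlr_eval (acomp1l _) eq_refl
    (tunit T x • tcell T (lunit m)) (idm a))
    : _ = el_act (lunit m) (el_unit (idm a))) as e1.
  rewrite e1 in e.
  etransitivity; [exact e|].
  change (el_unit (fmap (el_fun m) (idm a)) = el_unit (idm (el_fun m a))).
  now rewrite fmap1.
Qed.

Lemma el_lcomp_unitr {x y : B} (m : pro x y) (a : el_cat x) :
  pmap (el_prof (one y)) (el_lunit y (el_fun m a)
      ∘> el_lcomp m (lid y) a) (idm _) (el_act (runit m) (el_unit (idm a)))
  = el_unit (idm (el_fun m a)).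
Proof.
  pose proof (prof_ceq_elim (tw_lcomp_1r T m) (a := a) (b := a)
    (p := idm a) JMeq_refl) as e.
  apply JMeq_eq in e; unfold lcompc_cast in e; rewrite !unl_unl_lcompc in e.
  pose proof (JMeq_eq (castlr_eval (acomp1l _) eq_refl
    (tunit T x • tcell T (runit m)) (idm a))
    : _ = el_act (runit m) (el_unit (idm a))) as e1.
  rewrite e1 in e.
  transitivity (el_unit (fmap (el_fun m) (idm a))); [|now rewrite fmap1].
  etransitivity; [|exact e].
  unfold el_lunit, el_lcomp; cbn; now rewrite fmap1.
Qed.
End Elementwise.

Arguments el_lunit {B} T x a.
Arguments el_lcomp {B} T {x y z} m n a.
Arguments el_act {B} T {x y z w f m n g} s {a c} u.
Arguments el_comp {B} T {x y z f g a b c} u v.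
Arguments el_unit {B} T {x a b} u.

Lemma ceq_eq {H P Q K : Type} {C : H -> P -> Q -> K -> Type} {f m n g}
  (a b : C f m n g) : a ≡ b -> a = b.
Proof.
  intros e.
  assert (h : forall f' m' n' g' (b' : C f' m' n' g'), a ≡ b' ->
    forall (ef : f' = f) (em : m' = m) (en : n' = n) (eg : g' = g),
    a = eq_rect _ (fun f0 => C f0 m n g)
      (eq_rect _ (fun m0 => C f' m0 n g)
        (eq_rect _ (fun n0 => C f' m' n0 g)
          (eq_rect _ (fun g0 => C f' m' n' g0) b' _ eg) _ en) _ em) _ ef).
  { clear b e; intros f' m' n' g' b' [] ef em en eg.
    now rewrite (proof_irrelevance _ ef eq_refl), (proof_irrelevance _ em eq_refl),
      (proof_irrelevance _ en eq_refl), (proof_irrelevance _ eg eq_refl). }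
  exact (h _ _ _ _ b e eq_refl eq_refl eq_refl eq_refl).
Qed.

(** * The double category of elements *)

Definition is_iso {A : Cat} {a b : A} (u : hom a b) : Prop :=
  exists v : hom b a, u ∘> v = idm a /\ v ∘> u = idm b.

Lemma is_iso_id {A : Cat} (a : A) : is_iso (idm a).
Proof. exists (idm a); now rewrite mul1l. Qed.

Lemma is_iso_mul {A : Cat} {a b c : A} (u : hom a b) (v : hom b c) :
  is_iso u -> is_iso v -> is_iso (u ∘> v).
Proof.
  intros [u' [h h']] [v' [k k']]; exists (v' ∘> u').
  rewrite !mulA, <- (mulA v v' u'), k, mul1l, <- (mulA u' u v), h', mul1l; auto.
Qed.

Lemma is_iso_fmap {A A' : Cat} (F : Functor A A') {a b : A} (u : hom a b) :
  is_iso u -> is_iso (fmap F u).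
Proof.
  intros [v [h h']]; exists (fmap F v).
  now rewrite <- !fmapM, h, h', !fmap1.
Qed.

Section Elements.
Context {B : DblCat} (T : TwFun B Prof) (lax : is_lax T).

(** (T^{m,n})^{-1} and (T^x)^{-1} at an element *)
Definition el_lcompV {x y z : B} (m : pro x y) (n : pro y z) (a : el_cat T x) :
  hom (el_fun T (m ⊙ n) a) (el_fun T n (el_fun T m a)) :=
  pcell (proj1_sig (constructive_indefinite_description _
    (proj1 lax x y z m n))) a a (idm a).

Definition el_lunitV (x : B) (a : el_cat T x) : hom (el_fun T (lid x) a) a :=
  pcell (proj1_sig (constructive_indefinite_description _
    (proj2 lax x))) a a (idm a).
Arguments el_lunitV x a : clear implicits.

Lemma loose_inverse_eval {A A' : Prof} {F G : arr A A'}
  (s : cell F (lid A) (lid A') G) (t : cell G (lid A) (lid A') F) :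
  unl (s ⊛ t) ≡ lidc F -> forall a : cob A,
  (pcell s a a (idm a) : hom (fob F a) (fob G a))
  ∘> (pcell t a a (idm a) : hom (fob G a) (fob F a)) = idm (fob F a).
Proof.
  intros e a; apply ceq_eq in e.
  pose proof (f_equal (fun r : cell F (lid A) (lid A') F => pcell r a a (idm a)) e)
    as h; cbv beta in h.
  rewrite unl_lcompc in h; simpl in h; rewrite mul1r, fmap1 in h; exact h.
Qed.

Lemma el_lcompK {x y z : B} (m : pro x y) (n : pro y z) (a : el_cat T x) :
  el_lcomp T m n a ∘> el_lcompV m n a = idm _.
Proof.
  unfold el_lcompV.
  destruct (constructive_indefinite_description _ _) as [t [h h']].
  exact (loose_inverse_eval h a).
Qed.

Lemma el_lcompVK {x y z : B} (m : pro x y) (n : pro y z) (a : el_cat T x) :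
  el_lcompV m n a ∘> el_lcomp T m n a = idm _.
Proof.
  unfold el_lcompV.
  destruct (constructive_indefinite_description _ _) as [t [h h']].
  exact (loose_inverse_eval h' a).
Qed.

Lemma el_lunitK (x : B) (a : el_cat T x) :
  el_lunit T x a ∘> el_lunitV x a = idm _.
Proof.
  unfold el_lunitV.
  destruct (constructive_indefinite_description _ _) as [t [h h']].
  exact (loose_inverse_eval h a).
Qed.

Lemma el_lunitVK (x : B) (a : el_cat T x) :
  el_lunitV x a ∘> el_lunit T x a = idm _.
Proof.
  unfold el_lunitV.
  destruct (constructive_indefinite_description _ _) as [t [h h']].
  exact (loose_inverse_eval h' a).
Qed.

Record EltOb : Type := elt_pt { ebase : B; epoint : el_cat T ebase }.

Record EltArr (s t : EltOb) : Type := elt_mk_arr {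
  earr : arr (ebase s) (ebase t);
  eelt : el_prof T earr (epoint s) (epoint t)
}.

Record EltPro (s t : EltOb) : Type := elt_mk_pro {
  epro : pro (ebase s) (ebase t);
  emor : hom (el_fun T epro (epoint s)) (epoint t);
  emor_iso : is_iso emor
}.

Record EltCell (x y z w : EltOb) (f : EltArr x z) (m : EltPro x y)
  (n : EltPro z w) (g : EltArr y w) : Type := elt_mk_cell {
  ecell : cell (earr f) (epro m) (epro n) (earr g);
  ecell_eq :
    pmap (el_prof T (earr g)) (idm _) (emor n) (el_act T ecell (eelt f))
    = pmap (el_prof T (earr g)) (emor m) (idm _) (eelt g)
}.

Arguments elt_mk_arr s t earr eelt : clear implicits.
Arguments elt_mk_pro s t epro emor emor_iso : clear implicits.
Arguments elt_mk_cell {x y z w} f m n g ecell ecell_eq.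

Lemma elt_arr_eq {s t : EltOb} (u v : EltArr s t) :
  earr u = earr v -> JMeq (eelt u) (eelt v) -> u = v.
Proof.
  destruct u as [f u], v as [g v]; simpl; intros e; revert v; rewrite <- e.
  intros v h; now rewrite (JMeq_eq h).
Qed.

Lemma elt_cell_eq {x y z w : EltOb} {f : EltArr x z} {m : EltPro x y}
  {n : EltPro z w} {g : EltArr y w} (s t : EltCell f m n g) :
  ecell s = ecell t -> s = t.
Proof.
  destruct s as [s hs], t as [t ht]; simpl; intros e; revert ht; rewrite <- e.
  intros ht; now rewrite (proof_irrelevance _ hs ht).
Qed.

Lemma elt_ceq {x y z w : EltOb} {f f' : EltArr x z} {m : EltPro x y}
  {n : EltPro z w} {g g' : EltArr y w} (s : EltCell f m n g)
  (t : EltCell f' m n g') :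
  f = f' -> g = g' -> ecell s ≡ ecell t -> ceq (C := @EltCell x y z w) s t.
Proof.
  intros ef eg; revert t; rewrite <- ef, <- eg; intros t e.
  assert (s = t) as ->; [|constructor].
  apply elt_cell_eq, ceq_eq, e.
Qed.

Definition elt_one (s : EltOb) : EltArr s s :=
  elt_mk_arr s s (one (ebase s)) (el_unit T (idm (epoint s))).

Definition elt_acomp {s t r : EltOb} (u : EltArr s t) (v : EltArr t r) :
  EltArr s r :=
  elt_mk_arr s r (earr u · earr v) (el_comp T (eelt u) (eelt v)).

Definition elt_lid (s : EltOb) : EltPro s s.
Proof.
  refine (elt_mk_pro s s (lid (ebase s)) (el_lunitV (ebase s) (epoint s)) _).
  exists (el_lunit T (ebase s) (epoint s)); split;
    [apply el_lunitVK | apply el_lunitK].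
Defined.

Lemma el_lcompV_iso {x y z : B} (m : pro x y) (n : pro y z) (a : el_cat T x) :
  is_iso (el_lcompV m n a).
Proof.
  exists (el_lcomp T m n a); split; [apply el_lcompVK | apply el_lcompK].
Qed.

Definition elt_lcomp {s t r : EltOb} (m : EltPro s t) (n : EltPro t r) :
  EltPro s r :=
  elt_mk_pro s r (epro m ⊙ epro n)
    (el_lcompV (epro m) (epro n) (epoint s)
     ∘> (fmap (el_fun T (epro n)) (emor m) ∘> emor n))
    (is_iso_mul (el_lcompV_iso _ _ _)
      (is_iso_mul (is_iso_fmap _ (emor_iso m)) (emor_iso n))).

Lemma elt_acomp1l (s t : EltOb) (u : EltArr s t) : elt_acomp (elt_one s) u = u.
Proof.
  apply elt_arr_eq; simpl; [apply acomp1l|].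
  rewrite el_comp_unitl; now rewrite pmap1.
Qed.

Lemma elt_acomp1r (s t : EltOb) (u : EltArr s t) : elt_acomp u (elt_one t) = u.
Proof.
  apply elt_arr_eq; simpl; [apply acomp1r|].
  rewrite el_comp_unitr; now rewrite pmap1.
Qed.

Lemma elt_acompA (s t r q : EltOb) (u : EltArr s t) (v : EltArr t r)
  (w : EltArr r q) :
  elt_acomp (elt_acomp u v) w = elt_acomp u (elt_acomp v w).
Proof.
  apply elt_arr_eq; simpl; [apply acompA|]; apply el_comp_assoc.
Qed.

Definition elt_cone {s t : EltOb} (m : EltPro s t) :
  EltCell (elt_one s) m m (elt_one t).
Proof.
  refine (elt_mk_cell (elt_one s) m m (elt_one t) (cone (epro m)) _).
  abstract (simpl; rewrite el_act_unit, fmap1, el_unit_r, el_unit_l, mul1l, mul1r;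
            reflexivity).
Defined.

Definition elt_ccomp {x y z w u v : EltOb} {f : EltArr x z} {m : EltPro x y}
  {n : EltPro z w} {g : EltArr y w} {f' : EltArr z u} {p : EltPro u v}
  {g' : EltArr w v} (s : EltCell f m n g) (t : EltCell f' n p g') :
  EltCell (elt_acomp f f') m p (elt_acomp g g').
Proof.
  refine (elt_mk_cell (elt_acomp f f') m p (elt_acomp g g') (ecell s • ecell t) _).
  abstract (simpl; rewrite el_act_comp, !el_comp_nat, (ecell_eq t), pmap1,
    <- el_comp_dinat, (ecell_eq s), pmap1; reflexivity).
Defined.

Definition elt_lidc {s t : EltOb} (f : EltArr s t) :
  EltCell f (elt_lid s) (elt_lid t) f.
Proof.
  refine (elt_mk_cell f (elt_lid s) (elt_lid t) f (lidc (earr f)) _).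
  abstract (simpl;
    transitivity (pmap (el_prof T (earr f)) (el_lunitV (ebase s) (epoint s))
      (el_lunitV (ebase t) (epoint t))
      (pmap (el_prof T (earr f)) (el_lunit T (ebase s) (epoint s)) (idm _)
        (el_act T (lidc (earr f)) (eelt f))));
    [now rewrite pmapM', el_lunitVK, mul1l
    |now rewrite <- el_act_lid, pmapM', el_lunitK, mul1r]).
Defined.

Lemma elt_lcompc_eq {x y z u v w : EltOb} {f : EltArr x u} {g : EltArr y v}
  {h : EltArr z w} {m : EltPro x y} {m' : EltPro u v} {n : EltPro y z}
  {n' : EltPro v w} (s : EltCell f m m' g) (t : EltCell g n n' h) :
  pmap (el_prof T (earr h)) (idm _) (emor (elt_lcomp m' n'))
    (el_act T (ecell s ⊛ ecell t) (eelt f))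
  = pmap (el_prof T (earr h)) (emor (elt_lcomp m n)) (idm _) (eelt h).
Proof.
  simpl.
  transitivity (pmap (el_prof T (earr h)) (el_lcompV (epro m) (epro n) (epoint x))
    (el_lcompV (epro m') (epro n') (epoint u)
       ∘> (fmap (el_fun T (epro n')) (emor m') ∘> emor n'))
    (pmap (el_prof T (earr h)) (el_lcomp T (epro m) (epro n) (epoint x)) (idm _)
      (el_act T (ecell s ⊛ ecell t) (eelt f)))).
  { now rewrite pmapM', el_lcompVK, mul1l. }
  rewrite <- el_act_lcomp, pmapM', <- (mulA (el_lcomp T _ _ _)), el_lcompK,
    mul1l, mul1r.
  transitivity (pmap (el_prof T (earr h)) (el_lcompV (epro m) (epro n) (epoint x))
    (emor n') (el_act T (ecell t) (pmap (el_prof T (earr g)) (idm _) (emor m')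
      (el_act T (ecell s) (eelt f))))).
  { rewrite el_act_nat, pmapM', fmap1, mul1r; reflexivity. }
  rewrite (ecell_eq s), el_act_nat, fmap1, pmapM', mul1l.
  transitivity (pmap (el_prof T (earr h)) (el_lcompV (epro m) (epro n) (epoint x)
     ∘> fmap (el_fun T (epro n)) (emor m)) (idm _)
    (pmap (el_prof T (earr h)) (idm _) (emor n') (el_act T (ecell t) (eelt g)))).
  { now rewrite pmapM', mul1r, mul1r. }
  rewrite (ecell_eq t), pmapM', mul1r, mulA; reflexivity.
Qed.

Definition elt_lcompc {x y z u v w : EltOb} {f : EltArr x u} {g : EltArr y v}
  {h : EltArr z w} {m : EltPro x y} {m' : EltPro u v} {n : EltPro y z}
  {n' : EltPro v w} (s : EltCell f m m' g) (t : EltCell g n n' h) :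
  EltCell f (elt_lcomp m n) (elt_lcomp m' n') h :=
  elt_mk_cell f (elt_lcomp m n) (elt_lcomp m' n') h (ecell s ⊛ ecell t)
    (elt_lcompc_eq s t).

(** Cells over a globular cell of B, with identity tight sides *)
Definition elt_globular {s t : EltOb} (m n : EltPro s t)
  (a : cell (one (ebase s)) (epro m) (epro n) (one (ebase t)))
  (h : pmap (el_prof T (one (ebase t))) (idm _) (emor n)
         (el_act T a (el_unit T (idm (epoint s)))) = el_unit T (emor m)) :
  EltCell (elt_one s) m n (elt_one t).
Proof.
  refine (elt_mk_cell (elt_one s) m n (elt_one t) a _).
  abstract (simpl; rewrite h, el_unit_l; now rewrite mul1r).
Defined.

Arguments elt_globular {s t} m n a h.

Lemma elt_globular_inv {s t : EltOb} (m n : EltPro s t)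
  (a : cell (one (ebase s)) (epro m) (epro n) (one (ebase t)))
  (b : cell (one (ebase s)) (epro n) (epro m) (one (ebase t))) :
  a • b ≡ cone (epro m) ->
  pmap (el_prof T (one (ebase t))) (idm _) (emor n)
    (el_act T a (el_unit T (idm (epoint s)))) = el_unit T (emor m) ->
  pmap (el_prof T (one (ebase t))) (idm _) (emor m)
    (el_act T b (el_unit T (idm (epoint s)))) = el_unit T (emor n).
Proof.
  intros e h; destruct (emor_iso m) as [m' [hm hm']], (emor_iso n) as [n' [hn hn']].
  assert (ha : el_act T a (el_unit T (idm (epoint s)))
               = el_unit T (emor m ∘> n')).
  { rewrite <- el_unit_r, <- h, pmapM', hn, mul1l, pmap1; reflexivity. }
  assert (k : JMeq (el_act T (a • b) (el_comp T (el_unit T (idm (epoint s)))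
                                        (el_unit T (idm (epoint s)))))
                   (el_act T (cone (epro m)) (el_unit T (idm (epoint s))))).
  { apply el_act_ceq; [exact e|].
    rewrite el_comp_unitl; now rewrite pmap1. }
  rewrite el_act_comp, ha, el_act_unit, fmap1 in k.
  assert (k' : pmap (el_prof T (one (ebase t))) (emor m ∘> n') (idm _)
     (el_act T b (el_unit T (idm (epoint s)))) = el_unit T (idm _)).
  { apply JMeq_eq; rewrite <- k; symmetry; apply el_comp_unitl. }
  transitivity (pmap (el_prof T (one (ebase t))) (emor n ∘> m') (emor m)
    (pmap (el_prof T (one (ebase t))) (emor m ∘> n') (idm _)
     (el_act T b (el_unit T (idm (epoint s)))))).
  - rewrite pmapM', mulA, <- (mulA m'), hm', !mul1l, hn; reflexivity.
  - rewrite k', <- el_unit_nat, !mulA, mul1l, hm', mul1r; reflexivity.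
Qed.

Arguments elt_globular_inv {s t} m n a b.

Lemma elt_assoc_eq {s t r q : EltOb} (m : EltPro s t) (n : EltPro t r)
  (p : EltPro r q) :
  pmap (el_prof T (one (ebase q))) (idm _) (emor (elt_lcomp m (elt_lcomp n p)))
    (el_act T (assoc (epro m) (epro n) (epro p)) (el_unit T (idm (epoint s))))
  = el_unit T (emor (elt_lcomp (elt_lcomp m n) p)).
Proof.
  pose proof (el_lcomp_assoc (epro m) (epro n) (epro p) (epoint s)) as e.
  apply (f_equal (pmap (el_prof T (one (ebase q)))
    (el_lcompV (epro m ⊙ epro n) (epro p) (epoint s)
     ∘> fmap (el_fun T (epro p)) (el_lcompV (epro m) (epro n) (epoint s)))
    (emor (elt_lcomp m (elt_lcomp n p))))) in e.
  rewrite pmapM', mul1l, mulA, <- (mulA (fmap _ (el_lcompV _ _ _))), <- fmapM,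
    el_lcompVK, fmap1, mul1l, el_lcompVK in e.
  etransitivity; [exact e|].
  rewrite <- el_unit_nat; f_equal; simpl.
  rewrite !fmapM, !mulA; do 2 f_equal.
  rewrite <- (mulA (el_lcomp T (epro m) _ _)), el_lcompK, mul1l.
  rewrite <- (mulA (el_lcomp T (epro n) _ _)), <- el_lcomp_nat.
  rewrite mulA, <- (mulA (el_lcomp T (epro n) _ _)), el_lcompK, mul1l.
  reflexivity.
Qed.

Lemma elt_lunit_eq {s t : EltOb} (m : EltPro s t) :
  pmap (el_prof T (one (ebase t))) (idm _) (emor m)
    (el_act T (lunit (epro m)) (el_unit T (idm (epoint s))))
  = el_unit T (emor (elt_lcomp (elt_lid s) m)).
Proof.
  pose proof (el_lcomp_unitl (epro m) (epoint s)) as e.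
  apply (f_equal (pmap (el_prof T (one (ebase t)))
    (el_lcompV (lid (ebase s)) (epro m) (epoint s)
     ∘> fmap (el_fun T (epro m)) (el_lunitV (ebase s) (epoint s)))
    (emor m))) in e.
  rewrite pmapM', mul1l, mulA, <- (mulA (fmap _ (el_lunitV _ _))), <- fmapM,
    el_lunitVK, fmap1, mul1l, el_lcompVK in e.
  etransitivity; [exact e|].
  rewrite <- el_unit_nat, mul1r; simpl; now rewrite mulA.
Qed.

Lemma elt_runit_eq {s t : EltOb} (m : EltPro s t) :
  pmap (el_prof T (one (ebase t))) (idm _) (emor m)
    (el_act T (runit (epro m)) (el_unit T (idm (epoint s))))
  = el_unit T (emor (elt_lcomp m (elt_lid t))).
Proof.
  pose proof (el_lcomp_unitr (epro m) (epoint s)) as e.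
  apply (f_equal (pmap (el_prof T (one (ebase t)))
    (el_lcompV (epro m) (lid (ebase t)) (epoint s)
     ∘> el_lunitV (ebase t) (el_fun T (epro m) (epoint s)))
    (emor m))) in e.
  rewrite pmapM', mul1l, mulA, <- (mulA (el_lunitV _ _)), 
    el_lunitVK, mul1l, el_lcompVK in e.
  etransitivity; [exact e|].
  rewrite <- el_unit_nat, mul1r; simpl; rewrite mulA; do 2 f_equal.
  transitivity (el_lunitV (ebase t) (el_fun T (epro m) (epoint s))
    ∘> (emor m ∘> el_lunit T (ebase t) (epoint t))
    ∘> el_lunitV (ebase t) (epoint t)).
  - now rewrite !mulA, el_lunitK, mul1r.
  - now rewrite el_lunit_nat, <- mulA, el_lunitVK, mul1l.
Qed.

Definition EltData : DblData := {|
  dob := EltOb;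
  arr := EltArr;
  pro := EltPro;
  cell := EltCell;
  one := elt_one;
  acomp := @elt_acomp;
  cone := @elt_cone;
  ccomp := @elt_ccomp;
  lid := elt_lid;
  lcomp := @elt_lcomp;
  lidc := @elt_lidc;
  lcompc := @elt_lcompc;
  assoc := fun s t r q m n p =>
    elt_globular (elt_lcomp (elt_lcomp m n) p) (elt_lcomp m (elt_lcomp n p))
      (assoc (epro m) (epro n) (epro p)) (elt_assoc_eq m n p);
  assocV := fun s t r q m n p =>
    elt_globular (elt_lcomp m (elt_lcomp n p)) (elt_lcomp (elt_lcomp m n) p)
      (assocV (epro m) (epro n) (epro p))
      (elt_globular_inv (elt_lcomp (elt_lcomp m n) p)
         (elt_lcomp m (elt_lcomp n p)) (assoc (epro m) (epro n) (epro p)) _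
         (assocK _ _ _) (elt_assoc_eq m n p));
  lunit := fun s t m =>
    elt_globular (elt_lcomp (elt_lid s) m) m (lunit (epro m)) (elt_lunit_eq m);
  lunitV := fun s t m =>
    elt_globular m (elt_lcomp (elt_lid s) m) (lunitV (epro m))
      (elt_globular_inv (elt_lcomp (elt_lid s) m) m _ _ (lunitK _)
         (elt_lunit_eq m));
  runit := fun s t m =>
    elt_globular (elt_lcomp m (elt_lid t)) m (runit (epro m)) (elt_runit_eq m);
  runitV := fun s t m =>
    elt_globular m (elt_lcomp m (elt_lid t)) (runitV (epro m))
      (elt_globular_inv (elt_lcomp m (elt_lid t)) m _ _ (runitK _)
         (elt_runit_eq m))
|}.

Definition Elt : DblCat.
Proof.
  refine {| ddata := EltData |}.
  - exact elt_acomp1l.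
  - exact elt_acomp1r.
  - exact elt_acompA.
  - abstract (intros; apply elt_ceq;
      [apply elt_acomp1l | apply elt_acomp1l | apply ccomp1l]).
  - abstract (intros; apply elt_ceq;
      [apply elt_acomp1r | apply elt_acomp1r | apply ccomp1r]).
  - abstract (intros; apply elt_ceq;
      [apply elt_acompA | apply elt_acompA | apply ccompA]).
  - abstract (intros; apply elt_cell_eq, lidc_one).
  - abstract (intros; apply elt_cell_eq, lidc_comp).
  - abstract (intros; apply elt_cell_eq, lcompc_one).
  - abstract (intros; apply elt_cell_eq, lcompc_comp).
  - abstract (intros; apply elt_ceq;
      [apply elt_acomp1l | apply elt_acomp1l | apply assocK]).
  - abstract (intros; apply elt_ceq;
      [apply elt_acomp1l | apply elt_acomp1l | apply assocVK]).
  - abstract (intros; apply elt_ceq;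
      [exact (eq_trans (elt_acomp1r _) (eq_sym (elt_acomp1l _)))
      |exact (eq_trans (elt_acomp1r _) (eq_sym (elt_acomp1l _)))
      |apply assoc_nat]).
  - abstract (intros; apply elt_ceq;
      [apply elt_acomp1l | apply elt_acomp1l | apply lunitK]).
  - abstract (intros; apply elt_ceq;
      [apply elt_acomp1l | apply elt_acomp1l | apply lunitVK]).
  - abstract (intros; apply elt_ceq;
      [exact (eq_trans (elt_acomp1r _) (eq_sym (elt_acomp1l _)))
      |exact (eq_trans (elt_acomp1r _) (eq_sym (elt_acomp1l _)))
      |apply lunit_nat]).
  - abstract (intros; apply elt_ceq;
      [apply elt_acomp1l | apply elt_acomp1l | apply runitK]).
  - abstract (intros; apply elt_ceq;
      [apply elt_acomp1l | apply elt_acomp1l | apply runitVK]).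
  - abstract (intros; apply elt_ceq;
      [exact (eq_trans (elt_acomp1r _) (eq_sym (elt_acomp1l _)))
      |exact (eq_trans (elt_acomp1r _) (eq_sym (elt_acomp1l _)))
      |apply runit_nat]).
  - abstract (intros; apply elt_ceq;
      [symmetry; apply elt_acomp1r | symmetry; apply elt_acomp1r
      |apply pentagon]).
  - abstract (intros; apply elt_ceq;
      [apply elt_acomp1l | apply elt_acomp1l | apply triangle]).
Defined.
End Elements.
Arguments Elt {B} T lax.
Arguments elt_pt {B} T ebase epoint.
Arguments EltArr {B} T s t.
Arguments elt_mk_arr {B T} s t earr eelt.
Arguments elt_mk_pro {B T} s t epro emor emor_iso.
Arguments elt_mk_cell {B T x y z w} f m n g ecell ecell_eq.

(** Strict double functors *)
Record DblFun (D E : DblCat) : Type := {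
  dfun_ob :> D -> E;
  dfun_arr : forall x y : D, arr x y -> arr (dfun_ob x) (dfun_ob y);
  dfun_pro : forall x y : D, pro x y -> pro (dfun_ob x) (dfun_ob y);
  dfun_cell : forall (x y z w : D) (f : arr x z) (m : pro x y) (n : pro z w)
    (g : arr y w), cell f m n g ->
    cell (dfun_arr f) (dfun_pro m) (dfun_pro n) (dfun_arr g);
  dfun_one : forall x : D, dfun_arr (one x) = one (dfun_ob x);
  dfun_acomp : forall (x y z : D) (f : arr x y) (g : arr y z),
    dfun_arr (f · g) = dfun_arr f · dfun_arr g;
  dfun_cone : forall (x y : D) (m : pro x y),
    dfun_cell (cone m) ≡ cone (dfun_pro m);
  dfun_ccomp : forall (x y z w u v : D) (f : arr x z) (m : pro x y)
    (n : pro z w) (g : arr y w) (f' : arr z u) (p : pro u v) (g' : arr w v)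
    (a : cell f m n g) (b : cell f' n p g'),
    dfun_cell (a • b) ≡ dfun_cell a • dfun_cell b;
  dfun_lid : forall x : D, dfun_pro (lid x) = lid (dfun_ob x);
  dfun_lcomp : forall (x y z : D) (m : pro x y) (n : pro y z),
    dfun_pro (m ⊙ n) = dfun_pro m ⊙ dfun_pro n;
  dfun_lidc : forall (x y : D) (f : arr x y),
    dfun_cell (lidc f) ≡ lidc (dfun_arr f);
  dfun_lcompc : forall (x y z u v w : D) (f : arr x u) (g : arr y v)
    (h : arr z w) (m : pro x y) (m' : pro u v) (n : pro y z) (n' : pro v w)
    (a : cell f m m' g) (b : cell g n n' h),
    dfun_cell (a ⊛ b) ≡ dfun_cell a ⊛ dfun_cell b;
  dfun_assoc : forall (w x y z : D) (m : pro w x) (n : pro x y) (p : pro y z),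
    dfun_cell (assoc m n p) ≡ assoc (dfun_pro m) (dfun_pro n) (dfun_pro p);
  dfun_lunit : forall (x y : D) (m : pro x y),
    dfun_cell (lunit m) ≡ lunit (dfun_pro m);
  dfun_runit : forall (x y : D) (m : pro x y),
    dfun_cell (runit m) ≡ runit (dfun_pro m)
}.
Arguments dfun_arr {D E} d {x y} _.
Arguments dfun_pro {D E} d {x y} _.
Arguments dfun_cell {D E} d {x y z w f m n g} _.

Section TwOfElements.
Context {B : DblCat} (T : TwFun B Prof) (lax : is_lax T).

(** The projection P_T *)
Definition elt_proj : DblFun (Elt T lax) B.
Proof.
  refine {| dfun_ob := fun s : Elt T lax => ebase s : B;
            dfun_arr := fun s t (u : arr (d := Elt T lax) s t) => earr u;
            dfun_pro := fun s t (m : pro (d := Elt T lax) s t) => epro m;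
            dfun_cell := fun x y z w f m n g
              (s : cell (d := Elt T lax) f m n g) => ecell s |};
    reflexivity.
Defined.

(** The canonical cleavage of P_T: chosen lifts of proarrows and of cells *)
Definition elt_lift_ob (s : Elt T lax) {y : B} (m : pro (elt_proj s) y) :
  Elt T lax :=
  elt_pt T y (el_fun T m (epoint s)).
Arguments elt_lift_ob s {y} m.

Definition elt_lift_pro (s : Elt T lax) {y : B} (m : pro (elt_proj s) y) :
  pro s (elt_lift_ob s m) :=
  elt_mk_pro s (elt_lift_ob s m) m (idm _) (is_iso_id _).
Arguments elt_lift_pro s {y} m.

Definition elt_lift_arr {s t : Elt T lax} (h : arr s t) {y w : B}
  {m : pro (elt_proj s) y} {n : pro (elt_proj t) w} {g : arr y w}
  (a : cell (dfun_arr elt_proj h) m n g) :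
  arr (elt_lift_ob s m) (elt_lift_ob t n) :=
  elt_mk_arr (elt_lift_ob s m) (elt_lift_ob t n) g (el_act T a (eelt h)).
Arguments elt_lift_arr {s t} h {y w m n g} a.

Definition elt_lift_cell {s t : Elt T lax} (h : arr s t) {y w : B}
  {m : pro (elt_proj s) y} {n : pro (elt_proj t) w} {g : arr y w}
  (a : cell (dfun_arr elt_proj h) m n g) :
  cell h (elt_lift_pro s m) (elt_lift_pro t n) (elt_lift_arr h a) :=
  elt_mk_cell (h : EltArr T s t) (elt_lift_pro s m) (elt_lift_pro t n)
    (elt_lift_arr h a) a eq_refl.

(** * The twisted functor Tw(P_T) *)

(** An object of Elt(T) over [x] is a pair [(x, a)]; it is represented by its
    second component [a], and [elt_pt T x a] is the pair itself.  (The type of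
    all pairs lives in a universe that depends on the size of the objects of
    [B], while Tw(P_T)(x) has to be a small category.)
    An arrow over [f] is an arrow of Elt(T) that P_T sends to [f]. *)
Definition Over {x z : B} (f : arr x z) (a : el_cat T x) (c : el_cat T z) :
  Type :=
  {h : arr (elt_pt T x a : Elt T lax) (elt_pt T z c : Elt T lax)
     | dfun_arr elt_proj h = f}.

Definition over_comp {x y z : B} {f : arr x y} {g : arr y z} {k : arr x z}
  (e : f · g = k) {a b c} (u : Over f a b) (v : Over g b c) : Over k a c :=
  exist _ (proj1_sig u · proj1_sig v)
    (eq_trans (f_equal2 (fun f0 g0 => f0 · g0) (proj2_sig u) (proj2_sig v)) e).

Definition over_one {x : B} (a : el_cat T x) : Over (one x) a a :=
  exist _ (one (elt_pt T x a : Elt T lax)) eq_refl.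

(** α_!(h), the right arrow of the chosen lift of α at h; the cast only uses that
    P_T sends [h] to [f]. *)
Definition over_act {x y z w : B} {f : arr x z} {m : pro x y} {n : pro z w}
  {g : arr y w} (s : cell f m n g) {a c} (h : Over f a c) :
  Over g (el_fun T m a) (el_fun T n c) :=
  exist _ (elt_lift_arr (proj1_sig h)
             (castlr (eq_sym (proj2_sig h)) eq_refl s)) eq_refl.

(** The arrow (f, u) *)
Definition over_pair {x z : B} (f : arr x z) {a c} (u : el_prof T f a c) :
  Over f a c :=
  exist _ (elt_mk_arr (elt_pt T x a) (elt_pt T z c) f u
           : arr (elt_pt T x a : Elt T lax) (elt_pt T z c : Elt T lax)) eq_refl.

Arguments over_pair {x z} f {a c} u.

Lemma over_eq {x z : B} {f : arr x z} {a c} (u v : Over f a c) :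
  proj1_sig u = proj1_sig v -> u = v.
Proof. apply sig_eq. Qed.

Lemma over_JM {x z : B} {f f' : arr x z} {a c} (u : Over f a c)
  (v : Over f' a c) : f = f' -> proj1_sig u = proj1_sig v -> JMeq u v.
Proof.
  intros e; revert v; rewrite <- e; intros v h; now rewrite (@over_eq _ _ _ _ _ u v h).
Qed.

Lemma over_ind {x z : B} {f : arr x z} {a c} (X : Over f a c -> Prop) :
  (forall u, X (over_pair f u)) -> forall h, X h.
Proof.
  intros k [h e]; revert X k; rewrite <- e; intros X k; exact (k (eelt h)).
Qed.

Lemma over_pair_JM {x z : B} {f f' : arr x z} {a c} (u : el_prof T f a c)
  (v : el_prof T f' a c) :
  f = f' -> JMeq u v -> JMeq (over_pair f u) (over_pair f' v).
Proof.
  intros e; revert v; rewrite <- e; intros v h; now rewrite (JMeq_eq h).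
Qed.

Lemma over_comp_JM {x y z : B} {f : arr x y} {g : arr y z} {k : arr x z}
  (e : f · g = k) {a b c} (u : el_prof T f a b) (v : el_prof T g b c)
  (w : el_prof T k a c) :
  JMeq (el_comp T u v) w ->
  over_comp e (over_pair f u) (over_pair g v) = over_pair k w.
Proof. intros h; apply over_eq, elt_arr_eq; [exact e | exact h]. Qed.

Definition twe_cat (x : B) : Cat.
Proof.
  refine {| cob := el_cat T x;
            hom := Over (one x);
            idm := over_one;
            mul := fun a b c => over_comp (acomp1l (one x)) |}.
  - abstract (intros; apply over_eq, elt_acomp1l).
  - abstract (intros; apply over_eq, elt_acomp1r).
  - abstract (intros; apply over_eq, elt_acompA).
Defined.

Definition twe_prof {x z : B} (f : arr x z) : Profunctor (twe_cat x) (twe_cat z).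
Proof.
  refine {| pval := fun (a : twe_cat x) (c : twe_cat z) => Over f a c;
            pmap := fun a a' c c' (u : hom a' a) (v : hom c c') p =>
              over_comp (acomp1r f) (over_comp (acomp1l f) u p) v |}.
  - abstract (intros; apply over_eq; simpl;
      rewrite elt_acomp1l, elt_acomp1r; reflexivity).
  - abstract (intros; apply over_eq; simpl; rewrite !elt_acompA; reflexivity).
Defined.

(** The vertical arrow (1_x, T_x(u)) *)
Definition over_vert {x : B} {a b : el_cat T x} (u : hom a b) :
  hom (a : twe_cat x) (b : twe_cat x) :=
  over_pair (one x) (el_unit T u).

Lemma over_vert_mul {x : B} {a b c : el_cat T x} (u : hom a b) (v : hom b c) :
  over_vert (u ∘> v) = over_vert u ∘> over_vert v.
Proof.
  symmetry; apply over_comp_JM; rewrite el_comp_unitl; now rewrite el_unit_l.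
Qed.

Lemma twe_pmap_vert {x z : B} {f : arr x z} {a a' : el_cat T x}
  {c c' : el_cat T z} (u : hom a' a) (v : hom c c') (p : el_prof T f a c) :
  pmap (twe_prof f) (over_vert u) (over_vert v) (over_pair f p)
  = over_pair f (pmap (el_prof T f) u v p).
Proof.
  simpl; unfold over_vert.
  rewrite (over_comp_JM (acomp1l f) (el_comp_unitl _ _)).
  apply over_comp_JM; rewrite el_comp_unitr, pmapM', mul1l, mul1l; reflexivity.
Qed.

Lemma over_act_pair {x y z w : B} {f : arr x z} {m : pro x y} {n : pro z w}
  {g : arr y w} (s : cell f m n g) {a c} (u : el_prof T f a c) :
  over_act s (over_pair f u) = over_pair g (el_act T s u).
Proof. reflexivity. Qed.

Lemma over_act_ceq {x y z w : B} {f f' : arr x z} {m : pro x y} {n : pro z w}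
  {g g' : arr y w} (s : cell f m n g) (s' : cell f' m n g')
  {a c} (h : Over f a c) (h' : Over f' a c) :
  s ≡ s' -> f = f' -> g = g' -> proj1_sig h = proj1_sig h' ->
  JMeq (over_act s h) (over_act s' h').
Proof.
  intros e ef eg; revert s' h' e; rewrite <- ef, <- eg; intros s' h' e k.
  now rewrite (ceq_eq e), (@over_eq _ _ _ _ _ h h' k).
Qed.

Lemma over_act_comp {x y z w u v : B} {f : arr x z} {m : pro x y} {n : pro z w}
  {f' : arr y w} {g : arr z u} {p : pro u v} {g' : arr w v} {k k'}
  (s : cell f m n f') (t : cell g n p g') (r : cell k m p k') {a b c}
  (i : Over f a b) (j : Over g b c) (e : f · g = k) (e' : f' · g' = k') :
  s • t ≡ r ->
  over_act r (over_comp e i j) = over_comp e' (over_act s i) (over_act t j).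
Proof.
  revert r; rewrite <- e, <- e'; intros r h; rewrite <- (ceq_eq h).
  revert i; apply over_ind; intros i; revert j; apply over_ind; intros j.
  apply over_eq, elt_arr_eq; [reflexivity|].
  simpl; rewrite (proof_irrelevance _ (eq_sym _) eq_refl).
  exact (eq_JM (el_act_comp s t i j)).
Qed.

Definition twe_fun {x y : B} (m : pro x y) : Functor (twe_cat x) (twe_cat y).
Proof.
  refine {| fob := fun a : twe_cat x =>
              epoint (elt_lift_ob (elt_pt T x a) m) : twe_cat y;
            fmap := fun a b u => over_act (cone m) u |}.
  - abstract (intros a; apply over_eq, elt_arr_eq; [reflexivity|]; simpl;
      rewrite el_act_unit, fmap1; reflexivity).
  - abstract (intros; apply over_act_comp, ccomp1l).
Defined.

Definition twe_cell {x y z w : B} {f : arr x z} {m : pro x y} {n : pro z w}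
  {g : arr y w} (s : cell f m n g) :
  PCell (twe_fun m) (twe_prof f) (twe_prof g) (twe_fun n).
Proof.
  refine {| pcell := fun a c (p : twe_prof f a c) =>
              over_act s p : twe_prof g (twe_fun m a) (twe_fun n c) |}.
  abstract (intros; simpl;
    rewrite (over_act_comp (over_comp (acomp1l f) u p) v (acomp1r f) (acomp1r g)
               (ccomp1r s)), (over_act_comp u p (acomp1l f) (acomp1l g)
               (ccomp1l s)); reflexivity).
Defined.

Definition twe_tcomp_fun {x y z : B} (f : arr x y) (g : arr y z)
  (a : twe_cat x) (c : twe_cat z) :
  prof_comp (twe_prof f) (twe_prof g) a c -> twe_prof (f · g) a c :=
  coend_lift (fun b (u : twe_prof f a b) (v : twe_prof g b c) =>
    over_comp eq_refl u v).

Lemma twe_tcomp_tens {x y z : B} (f : arr x y) (g : arr y z)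
  (a : twe_cat x) (c : twe_cat z) b (u : twe_prof f a b) (v : twe_prof g b c) :
  twe_tcomp_fun (tens u v) = over_comp eq_refl u v.
Proof.
  unfold twe_tcomp_fun; rewrite coend_lift_tens; [reflexivity|].
  clear; intros b b' w p q; apply over_eq; simpl.
  now rewrite elt_acomp1l, elt_acomp1r, elt_acompA.
Qed.

Definition twe_tcomp {x y z : B} (f : arr x y) (g : arr y z) :
  PCell (functor_id (twe_cat x)) (prof_comp (twe_prof f) (twe_prof g))
    (twe_prof (f · g)) (functor_id (twe_cat z)).
Proof.
  refine {| pcell := fun a c => @twe_tcomp_fun x y z f g a c
    : _ -> twe_prof (f · g) (functor_id (twe_cat x) a) (functor_id (twe_cat z) c) |}.
  abstract (intros; revert p; apply coend_ind; intros b0 p q;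
    rewrite tens_pmap, !twe_tcomp_tens; apply over_eq; simpl;
    rewrite elt_acomp1l, elt_acomp1r, !elt_acompA; reflexivity).
Defined.

Definition twe_tunit (x : B) :
  PCell (functor_id (twe_cat x)) (hom_prof (twe_cat x)) (twe_prof (one x))
    (functor_id (twe_cat x)).
Proof.
  refine {| pcell := fun a b (u : hom_prof (twe_cat x) a b) =>
    u : twe_prof (one x) (functor_id (twe_cat x) a) (functor_id (twe_cat x) b) |}.
  abstract (intros; apply over_eq; reflexivity).
Defined.

(** The loosely globular cell corresponding to a natural transformation *)
Definition nat_pcell {C D : Cat} (F G : Functor C D)
  (t : forall a : C, hom (F a) (G a))
  (ht : forall (a b : C) (u : hom a b), fmap F u ∘> t b = t a ∘> fmap G u) :
  PCell F (hom_prof C) (hom_prof D) G.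
Proof.
  refine {| pcell := fun a b (u : hom_prof C a b) =>
              fmap F u ∘> t b : hom_prof D (F a) (G b) |}.
  abstract (intros; simpl; rewrite !fmapM, !mulA, ht; reflexivity).
Defined.

Arguments nat_pcell {C D} F G t ht.

Lemma twe_lcomp_nat {x y z : B} (m : pro x y) (n : pro y z) (a b : twe_cat x)
  (u : hom a b) :
  fmap (functor_comp (twe_fun m) (twe_fun n)) u ∘> over_vert (el_lcomp T m n b)
  = over_vert (el_lcomp T m n a) ∘> fmap (twe_fun (m ⊙ n)) u.
Proof.
  revert u; apply over_ind; intros u; simpl.
  rewrite !over_act_pair.
  transitivity (over_pair (one z) (pmap (el_prof T (one z)) (idm _)
    (el_lcomp T m n b) (el_act T (cone n) (el_act T (cone m) u)))).
  { apply over_comp_JM, el_comp_unitr. }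
  rewrite el_act_lcomp, lcompc_one.
  symmetry; apply over_comp_JM, el_comp_unitl.
Qed.

Lemma twe_lunit_nat {x : B} (a b : twe_cat x) (u : hom a b) :
  fmap (functor_id (twe_cat x)) u ∘> over_vert (el_lunit T x b)
  = over_vert (el_lunit T x a) ∘> fmap (twe_fun (lid x)) u.
Proof.
  revert u; apply over_ind; intros u; simpl.
  rewrite !over_act_pair.
  transitivity (over_pair (one x) (pmap (el_prof T (one x)) (idm _)
    (el_lunit T x b) u)).
  { apply over_comp_JM, el_comp_unitr. }
  rewrite el_act_lid, lidc_one.
  symmetry; apply over_comp_JM, el_comp_unitl.
Qed.

Definition twe_lcomp {x y z : B} (m : pro x y) (n : pro y z) :
  PCell (functor_comp (twe_fun m) (twe_fun n)) (hom_prof (twe_cat x))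
    (hom_prof (twe_cat z)) (twe_fun (m ⊙ n)) :=
  nat_pcell (functor_comp (twe_fun m) (twe_fun n)) (twe_fun (m ⊙ n))
    (fun a => over_vert (el_lcomp T m n a)) (twe_lcomp_nat m n).

Definition twe_lunit (x : B) :
  PCell (functor_id (twe_cat x)) (hom_prof (twe_cat x)) (hom_prof (twe_cat x))
    (twe_fun (lid x)) :=
  nat_pcell (functor_id (twe_cat x)) (twe_fun (lid x))
    (fun a => over_vert (el_lunit T x a)) (@twe_lunit_nat x).

Definition TwElt_data : TwData B Prof := {|
  tob := twe_cat : B -> Prof;
  tarr := @twe_prof;
  tpro := @twe_fun;
  tcell := @twe_cell;
  tcomp := @twe_tcomp;
  tunit := twe_tunit;
  tlcomp := @twe_lcomp;
  tlunit := twe_lunit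
|}.

Lemma el_act_globular {x y : B} {m n : pro x y}
  (s : cell (one x) m n (one y)) {a b : el_cat T x} {a' : el_cat T y}
  (p : hom a' (el_fun T m a)) (q : hom a' (el_fun T n a)) :
  pmap (el_prof T (one y)) p (idm _) (el_act T s (el_unit T (idm a)))
  = el_unit T q ->
  forall w : el_prof T (one x) a b,
  pmap (el_prof T (one y)) p (idm _) (el_act T s w)
  = pmap (el_prof T (one y)) q (idm _) (el_act T (cone n) w).
Proof.
  intros h w.
  assert (pJM : forall (f f' : arr y y) c (u : el_prof T f (el_fun T m a) c)
    (v : el_prof T f' (el_fun T m a) c), f = f' -> JMeq u v ->
    JMeq (pmap (el_prof T f) p (idm _) u) (pmap (el_prof T f') p (idm _) v)).
  { intros f f' c u v e; revert v; rewrite <- e; intros v k.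
    now rewrite (JMeq_eq k). }
  assert (k : JMeq (pmap (el_prof T (one y)) p (idm _) (el_act T s w))
    (pmap (el_prof T (one y · one y)) p (idm _)
      (el_comp T (el_act T s (el_unit T (idm a))) (el_act T (cone n) w)))).
  { apply pJM; [symmetry; apply acomp1l|].
    rewrite <- el_act_comp.
    assert (e : s • cone n ≡ s) by apply ccomp1r.
    assert (e' : JMeq (el_comp T (el_unit T (idm a)) w) w).
    { rewrite el_comp_unitl, pmap1; reflexivity. }
    rewrite (el_act_ceq e e'); reflexivity. }
  rewrite el_comp_nat, h, pmap1 in k.
  apply JMeq_eq; rewrite k; apply el_comp_unitl.
Qed.

Lemma nat_pcell_one {C D : Cat} (F G : Functor C D) t ht (a : C) :
  nat_pcell F G t ht a a (idm a) = t a.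
Proof. simpl; now rewrite fmap1, mul1l. Qed.

Lemma twe_lcomp_one {x y z : B} (m : pro x y) (n : pro y z) (a : twe_cat x) :
  pcell (tlcomp TwElt_data m n) a a (idm a) = over_vert (el_lcomp T m n a).
Proof. exact (@nat_pcell_one _ _
  (functor_comp (twe_fun m) (twe_fun n)) (twe_fun (m ⊙ n))
  (fun a => over_vert (el_lcomp T m n a))
  (twe_lcomp_nat m n) a). Qed.

Lemma twe_lunit_one {x : B} (a : twe_cat x) :
  pcell (tlunit TwElt_data x) a a (idm a) = over_vert (el_lunit T x a).
Proof. exact (@nat_pcell_one _ _ (functor_id (twe_cat x))
  (twe_fun (lid x)) (fun a => over_vert (el_lunit T x a))
  (@twe_lunit_nat x) a). Qed.

Lemma twe_lcomp_cell_nat (x y z u v w : B) (f : arr x u) (g : arr y v) (h : arr z w)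
  (m : pro x y) (m' : pro u v) (n : pro y z) (n' : pro v w)
  (a : cell f m m' g) (b : cell g n n' h) :
  unr ((tcell TwElt_data a • tcell TwElt_data b) ⊛ tlcomp TwElt_data m' n')
  = unl (tlcomp TwElt_data m n ⊛ tcell TwElt_data (a ⊛ b)).
Proof.
  apply pcell_ext; intros i j k.
  etransitivity; [apply unr_lcompc|]; etransitivity; [|symmetry; apply unl_lcompc].
  rewrite !twe_lcomp_one.
  revert k; apply over_ind; intros k.
  etransitivity; [exact (twe_pmap_vert (idm _) (el_lcomp T m' n' j)
    (el_act T b (el_act T a k)))|].
  rewrite el_act_lcomp; symmetry; apply twe_pmap_vert.
Qed.

Lemma twe_lunit_cell_nat (x y : B) (f : arr x y) :
  unr (cone (tarr TwElt_data f) ⊛ tlunit TwElt_data y)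
  = unl (tlunit TwElt_data x ⊛ tcell TwElt_data (lidc f)).
Proof.
  apply pcell_ext; intros i j k.
  etransitivity; [apply unr_lcompc|]; etransitivity; [|symmetry; apply unl_lcompc].
  rewrite !twe_lunit_one.
  revert k; apply over_ind; intros k.
  etransitivity; [exact (twe_pmap_vert (idm _) (el_lunit T y j) k)|].
  rewrite el_act_lid; symmetry; apply twe_pmap_vert.
Qed.

Lemma twe_fun_vert {x y : B} (m : pro x y) {a b : el_cat T x} (u : hom a b) :
  fmap (twe_fun m) (over_vert u) = over_vert (fmap (el_fun T m) u).
Proof.
  apply over_eq, elt_arr_eq; [reflexivity|]; apply eq_JM, el_act_unit.
Qed.

Lemma twe_globular {x y : B} {m n : pro x y} (s : cell (one x) m n (one y))
  {a b : el_cat T x} {a' : el_cat T y}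
  (p : hom a' (el_fun T m a)) (q : hom a' (el_fun T n a)) :
  pmap (el_prof T (one y)) p (idm _) (el_act T s (el_unit T (idm a)))
  = el_unit T q ->
  forall w : Over (one x) a b,
  pmap (twe_prof (one y)) (over_vert p) (idm _) (over_act s w)
  = pmap (twe_prof (one y)) (over_vert q) (idm _) (over_act (cone n) w).
Proof.
  intros h; apply over_ind; intros w.
  etransitivity; [exact (twe_pmap_vert p (idm _) (el_act T s w))|].
  rewrite (el_act_globular h); symmetry; apply twe_pmap_vert.
Qed.

Lemma twe_lcomp_assoc (w x y z : B) (m : pro w x) (n : pro x y) (p : pro y z) :
  unl (unl ((tlcomp TwElt_data m n • lidc (tpro TwElt_data p))
      ⊛ lcompc_cast (tlcomp TwElt_data (m ⊙ n) p) (acomp1l _)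
          (tunit TwElt_data w • tcell TwElt_data (assoc m n p))))
  ≡ unl (unl ((lidc (tpro TwElt_data m) • tlcomp TwElt_data n p)
      ⊛ lcompc_cast (tlcomp TwElt_data m (n ⊙ p)) (acomp1r _)
          (lidc (tpro TwElt_data (m ⊙ (n ⊙ p))) • tunit TwElt_data z))).
Proof.
  prof_ceq; intros a b k; unfold lcompc_cast; rewrite !unl_unl_lcompc.
  pose proof (JMeq_eq (castlr_eval (acomp1l _) eq_refl
    (tunit TwElt_data w • tcell TwElt_data (assoc m n p)) k)
    : _ = over_act (assoc m n p) k) as e1.
  pose proof (JMeq_eq (castlr_eval (acomp1r _) eq_refl
    (lidc (tpro TwElt_data (m ⊙ (n ⊙ p))) • tunit TwElt_data z) k)
    : _ = over_act (cone (m ⊙ (n ⊙ p))) k) as e2.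
  assert (h1 : pcell (tlcomp TwElt_data m n • lidc (tpro TwElt_data p)) a a
    (idm a) = over_vert (fmap (el_fun T p) (el_lcomp T m n a))).
  { etransitivity; [exact (f_equal (fun u => fmap (twe_fun p) u)
      (twe_lcomp_one m n a))|]; apply twe_fun_vert. }
  assert (h2 : pcell (lidc (tpro TwElt_data m) • tlcomp TwElt_data n p) a a
    (idm a) = over_vert (el_lcomp T n p (el_fun T m a))).
  { etransitivity; [exact (f_equal (pcell (tlcomp TwElt_data n p) _ _)
      (fmap1 (twe_fun m) a))|]; exact (twe_lcomp_one n p (el_fun T m a)). }
  rewrite e1, e2, !twe_lcomp_one, h1, h2; apply eq_JM.
  pose proof (twe_globular (el_lcomp_assoc m n p a) k) as e.
  rewrite !over_vert_mul in e; exact e.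
Qed.

Lemma twe_lcomp_1l (x y : B) (m : pro x y) :
  unl (unl ((tlunit TwElt_data x • lidc (tpro TwElt_data m))
      ⊛ lcompc_cast (tlcomp TwElt_data (lid x) m) (acomp1l _)
          (tunit TwElt_data x • tcell TwElt_data (lunit m))))
  ≡ lidc (tpro TwElt_data m) • tunit TwElt_data y.
Proof.
  prof_ceq; intros a b k; unfold lcompc_cast; rewrite !unl_unl_lcompc.
  pose proof (JMeq_eq (castlr_eval (acomp1l _) eq_refl
    (tunit TwElt_data x • tcell TwElt_data (lunit m)) k)
    : _ = over_act (lunit m) k) as e1.
  assert (h1 : pcell (tlunit TwElt_data x • lidc (tpro TwElt_data m)) a a
    (idm a) = over_vert (fmap (el_fun T m) (el_lunit T x a))).
  { etransitivity; [exact (f_equal (fun u => fmap (twe_fun m) u)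
      (twe_lunit_one a))|]; apply twe_fun_vert. }
  rewrite e1, !twe_lcomp_one, h1; apply eq_JM.
  pose proof (twe_globular (el_lcomp_unitl m a) k) as e.
  rewrite over_vert_mul in e.
  etransitivity; [exact e|]; exact (@pmap1 _ _ (twe_prof (one y)) _ _ (over_act (cone m) k)).
Qed.

Lemma twe_lcomp_1r (x y : B) (m : pro x y) :
  unl (unl ((lidc (tpro TwElt_data m) • tlunit TwElt_data y)
      ⊛ lcompc_cast (tlcomp TwElt_data m (lid y)) (acomp1l _)
          (tunit TwElt_data x • tcell TwElt_data (runit m))))
  ≡ lidc (tpro TwElt_data m) • tunit TwElt_data y.
Proof.
  prof_ceq; intros a b k; unfold lcompc_cast; rewrite !unl_unl_lcompc.
  pose proof (JMeq_eq (castlr_eval (acomp1l _) eq_refl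
    (tunit TwElt_data x • tcell TwElt_data (runit m)) k)
    : _ = over_act (runit m) k) as e1.
  assert (h1 : pcell (lidc (tpro TwElt_data m) • tlunit TwElt_data y) a a
    (idm a) = over_vert (el_lunit T y (el_fun T m a))).
  { etransitivity; [exact (f_equal (pcell (tlunit TwElt_data y) _ _)
      (fmap1 (twe_fun m) a))|]; exact (twe_lunit_one (el_fun T m a : twe_cat y)). }
  rewrite e1, !twe_lcomp_one, h1; apply eq_JM.
  pose proof (twe_globular (el_lcomp_unitr m a) k) as e.
  rewrite over_vert_mul in e.
  etransitivity; [exact e|]; exact (@pmap1 _ _ (twe_prof (one y)) _ _ (over_act (cone m) k)).
Qed.

Lemma eq_ceq {H P Q K : Type} {C : H -> P -> Q -> K -> Type} {f m n g}
  (a b : C f m n g) : a = b -> a ≡ b.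
Proof. intros ->; constructor. Qed.

Definition TwElt : TwFun B Prof.
Proof.
  refine {| tdata := TwElt_data |}.
  - abstract (intros; prof_ceq; intros i j k; revert k; apply coend_ind;
      intros; apply eq_JM; simpl;
      rewrite pcell_lcomp_fun_tens; simpl; rewrite !twe_tcomp_tens;
      symmetry; apply over_act_comp; constructor).
  - abstract (intros; prof_ceq; reflexivity).
  - abstract (intros; apply eq_ceq, twe_lcomp_cell_nat).
  - abstract (intros; apply eq_ceq, twe_lunit_cell_nat).
  - abstract (intros; apply prof_ceq_gen;
      [functor_conv|functor_conv|simpl; now rewrite acompA|]; intros i j k;
      revert k; apply coend_ind; intros c e t; revert e; apply coend_ind;
      intros; simpl; rewrite !pcell_lcomp_fun_tens; simpl;
      rewrite pcell_assoc_tens, pcell_lcomp_fun_tens; simpl;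
      rewrite !twe_tcomp_tens; apply over_JM; [apply acompA | apply elt_acompA]).
  - abstract (intros; apply prof_ceq_gen;
      [functor_conv|functor_conv|simpl; now rewrite acomp1l|]; intros i j k;
      revert k; apply coend_ind; intros c u v;
      pose proof (pcell_lunit_tens (P := twe_prof f) u v) as e; simpl;
      etransitivity; [|apply eq_JM; symmetry; exact e];
      rewrite !pcell_lcomp_fun_tens; simpl;
      rewrite twe_tcomp_tens; apply over_JM; [apply acomp1l|];
      symmetry; apply elt_acomp1r).
  - abstract (intros; apply prof_ceq_gen;
      [functor_conv|functor_conv|simpl; now rewrite acomp1r|]; intros i j k;
      revert k; apply coend_ind; intros c u v;
      pose proof (pcell_runit_tens (P := twe_prof f) u v) as e; simpl;
      etransitivity; [|apply eq_JM; symmetry; exact e];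
      rewrite !pcell_lcomp_fun_tens; simpl;
      rewrite twe_tcomp_tens; apply over_JM; [apply acomp1r|]; simpl;
      rewrite elt_acomp1l; reflexivity).
  - exact twe_lcomp_assoc.
  - exact twe_lcomp_1l.
  - exact twe_lcomp_1r.
Defined.
End TwOfElements.

Arguments TwElt {B} T lax.
Arguments Over {B T lax x z} f a c.

(** Arrows of a double category with unspecified source and target *)
Record Arrow (D : DblData) : Type := mk_arrow {
  asrc : D;
  atgt : D;
  aarr : arr asrc atgt
}.
Arguments mk_arrow {D asrc atgt} aarr.

(** The arrow (f, u) : (x, a) -> (z, c) of Elt(T) *)
Definition elt_pair {B : DblCat} (T : TwFun B Prof) (lax : is_lax T) {x z : B}
  (f : arr x z) {a : el_cat T x} {c : el_cat T z} (u : el_prof T f a c) :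
  Arrow (Elt T lax) :=
  mk_arrow (elt_mk_arr (elt_pt T x a) (elt_pt T z c) f u
            : arr (elt_pt T x a : Elt T lax) (elt_pt T z c : Elt T lax)).

(** The arrow of Elt(T) underlying an arrow over [f] *)
Definition over_arrow {B : DblCat} {T : TwFun B Prof} {lax : is_lax T}
  {x z : B} {f : arr x z} {a : el_cat T x} {c : el_cat T z}
  (h : Over (lax := lax) f a c) : Arrow (Elt T lax) :=
  mk_arrow (proj1_sig h).
Arguments elt_pair {B} T lax {x z} f {a c} u.
Arguments over_pair {B T} lax {x z} f {a c} u.

(* Main.v *)
From Stdlib Require Import FunctionalExtensionality IndefiniteDescription JMeq.
Require Import Defs.

(** An arrow of Elt(T) over [f] is the same thing as an element of [T f], so
    [γ] is bijective on arrows over any [f].  On vertical arrows it is the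
    comparison [T_x], so that each functor [γ_x], the identity on objects, is
    invertible exactly because [T] is normal.  When the naturality comparisons
    are loose identities, they drop out of the axioms of a transformation, which
    can then be checked on elements, for [γ] and for its componentwise inverse. *)

(** * Equality of cells together with their frames *)

Lemma ceq_sym {H P Q K : Type} {C : H -> P -> Q -> K -> Type} {f m n g}
  {a : C f m n g} {f' m' n' g'} {b : C f' m' n' g'} : a ≡ b -> b ≡ a.
Proof. now intros []. Qed.

Lemma ceq_trans {H P Q K : Type} {C : H -> P -> Q -> K -> Type} {f m n g}
  {a : C f m n g} {f' m' n' g'} {b : C f' m' n' g'} {f'' m'' n'' g''}
  {c : C f'' m'' n'' g''} : a ≡ b -> b ≡ c -> a ≡ c.
Proof. now intros []. Qed.

(** Destructing the frame equalities read off here puts both cells in one type, where [ceq_eq] makes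
    them Leibniz equal. *)
Lemma ceq_left {H P Q K : Type} {C : H -> P -> Q -> K -> Type} {f m n g}
  {a : C f m n g} {f' m' n' g'} {b : C f' m' n' g'} : a ≡ b -> f = f'.
Proof. now intros []. Qed.

Lemma ceq_right {H P Q K : Type} {C : H -> P -> Q -> K -> Type} {f m n g}
  {a : C f m n g} {f' m' n' g'} {b : C f' m' n' g'} : a ≡ b -> g = g'.
Proof. now intros []. Qed.

Lemma ceq_bot {H P Q K : Type} {C : H -> P -> Q -> K -> Type} {f m n g}
  {a : C f m n g} {f' m' n' g'} {b : C f' m' n' g'} : a ≡ b -> n = n'.
Proof. now intros []. Qed.

(** * Congruence and cancellation of loose identities *)

Section CellEquality.
Context {D : DblCat}.

Lemma castlr_ceq {x y z w : D} {f f' : arr x z} {m : pro x y} {n : pro z w}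
  {g g' : arr y w} (ef : f = f') (eg : g = g') (a : cell f m n g) :
  castlr ef eg a ≡ a.
Proof. now destruct ef, eg. Qed.

Lemma ccomp_ceq {x y z w u v : D} {f f1 : arr x z} {m m1 : pro x y}
  {n n1 : pro z w} {g g1 : arr y w} {f' f1' : arr z u} {p p1 : pro u v}
  {g' g1' : arr w v} {a : cell f m n g} {a1 : cell f1 m1 n1 g1}
  {b : cell f' n p g'} {b1 : cell f1' n1 p1 g1'} :
  a ≡ a1 -> b ≡ b1 -> a • b ≡ a1 • b1.
Proof.
  intros e; revert b1; destruct e; intros b1 e'.
  pose proof (ceq_left e') as ef; pose proof (ceq_bot e') as ep;
    pose proof (ceq_right e') as eg.
  destruct ef, ep, eg; now rewrite (ceq_eq e').
Qed.

Lemma lidc_ceq {x y : D} {f g : arr x y} : f = g -> lidc f ≡ lidc g.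
Proof. now intros []. Qed.

Lemma lidc_comp_ceq {x y z : D} {f f' : arr x y} {g g' : arr y z}
  {a : cell f (lid x) (lid y) f'} {b : cell g (lid y) (lid z) g'}
  {h : arr x y} {k : arr y z} :
  a ≡ lidc h -> b ≡ lidc k -> a • b ≡ lidc (h · k).
Proof. intros e e'; rewrite lidc_comp; exact (ccomp_ceq e e'). Qed.

Lemma unl_ceq {x y z w : D} {f f' : arr x z} {m : pro x y} {n : pro z w}
  {g g' : arr y w} {a : cell f (lid x ⊙ m) (lid z ⊙ n) g}
  {b : cell f' (lid x ⊙ m) (lid z ⊙ n) g'} : a ≡ b -> unl a ≡ unl b.
Proof.
  intros e; pose proof (ceq_left e) as ef; pose proof (ceq_right e) as eg.
  destruct ef, eg; now rewrite (ceq_eq e).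
Qed.

(** Naturality of the left unitor moves [t] past it, and the unitor then cancels against
    [lunitV]. *)
Lemma unl_lidc {x y z w : D} {f g h : arr x z} {m : pro x y} {n : pro z w}
  {k : arr y w} {s : cell f (lid x) (lid z) g} {t : cell g m n k} :
  s ≡ lidc h -> unl (s ⊛ t) ≡ t.
Proof.
  intros e; pose proof (ceq_left e) as ef; pose proof (ceq_right e) as eg.
  destruct ef, eg; rewrite (ceq_eq e).
  eapply ceq_trans; [apply castlr_ceq|].
  eapply ceq_trans; [exact (ccomp_ceq ceq_refl (lunit_nat t))|].
  eapply ceq_trans; [apply ceq_sym, ccompA|].
  eapply ceq_trans; [exact (ccomp_ceq (lunitVK m) ceq_refl)|].
  apply ccomp1l.
Qed.

Lemma unr_lidc {x y z w : D} {f : arr x z} {m : pro x y} {n : pro z w}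
  {g k h : arr y w} {s : cell f m n g} {t : cell g (lid y) (lid w) k} :
  t ≡ lidc h -> unr (s ⊛ t) ≡ s.
Proof.
  intros e; pose proof (ceq_left e) as ef; pose proof (ceq_right e) as eg.
  destruct ef, eg; rewrite (ceq_eq e).
  eapply ceq_trans; [apply castlr_ceq|].
  eapply ceq_trans; [exact (ccomp_ceq ceq_refl (runit_nat s))|].
  eapply ceq_trans; [apply ceq_sym, ccompA|].
  eapply ceq_trans; [exact (ccomp_ceq (runitVK m) ceq_refl)|].
  apply ccomp1l.
Qed.
End CellEquality.

(** In [Prof] the two unitors of a loose identity visibly agree, so a loose
    identity can be cancelled against either of them. *)
Lemma unl_lidc_r {A A' : Prof} {F G H K : arr A A'}
  {s : cell F (lid A) (lid A') G} {t : cell G (lid A) (lid A') H} :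
  t ≡ lidc K -> unl (s ⊛ t) ≡ s.
Proof.
  intros e; pose proof (ceq_left e) as ef; pose proof (ceq_right e) as eg.
  destruct ef, eg; rewrite (ceq_eq e).
  apply eq_ceq, pcell_ext; intros a b u; rewrite unl_lcompc; simpl.
  rewrite mul1r; symmetry.
  (* Writing [u] as [u] acting on an identity lets naturality of [s] split its value into the
     component at [a] followed by the image of [u]. *)
  transitivity (pcell s a b (pmap (hom_prof A) (idm a) u (idm a))).
  - simpl; now rewrite !mul1l.
  - rewrite (pcell_nat s); simpl; now rewrite fmap1, mul1l.
Qed.

(** * Strict transformations into [Prof] *)

Section Strict.
Context {D : DblCat}.

(** The two sides [e] identifies are equal but need not be convertible, so the loose identity is
    transported along [e]. *)
Definition strict_data {F G : TwFun D Prof} (o : forall x : D, arr (F x) (G x))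
  (c : forall (x y : D) (f : arr x y),
     cell (o x) (tarr F f) (tarr G f) (o y))
  (e : forall (x y : D) (m : pro x y), o x · tpro G m = tpro F m · o y) :
  NatData F G :=
  {| nob := o; narr := c;
     npro := fun x y m => castlr eq_refl (e x y m) (lidc (o x · tpro G m)) |}.

(** The hypotheses are the axioms with the naturality comparisons cancelled. Proofs of axioms are
    sealed while the data stay transparent, so that equations on elements can later hold by
    conversion. *)
Definition strict_nat {F G : TwFun D Prof} (o : forall x : D, arr (F x) (G x))
  (c : forall (x y : D) (f : arr x y),
     cell (o x) (tarr F f) (tarr G f) (o y))
  (e : forall (x y : D) (m : pro x y), o x · tpro G m = tpro F m · o y)
  (hcell : forall (x y z w : D) (f : arr x z) (m : pro x y) (n : pro z w)
     (g : arr y w) (s : cell f m n g),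
     c x z f • tcell G s ≡ tcell F s • c y w g)
  (hcomp : forall (x y z : D) (f : arr x y) (g : arr y z),
     (c x y f ⊛ c y z g) • tcomp G f g ≡ tcomp F f g • c x z (f · g))
  (hunit : forall x : D,
     lidc (o x) • tunit G x ≡ tunit F x • c x x (one x))
  (hlcomp : forall (x y z : D) (m : pro x y) (n : pro y z),
     tlcomp F m n • lidc (o z) ≡ lidc (o x) • tlcomp G m n)
  (hlunit : forall x : D,
     tlunit F x • lidc (o x) ≡ lidc (o x) • tlunit G x) :
  LaxNat F G.
Proof.
  refine {| ndata := strict_data o c e |}.
  - abstract (intros; eapply ceq_trans; [exact (unr_lidc (castlr_ceq _ _ _))|];
      eapply ceq_trans; [apply hcell|];
      apply ceq_sym; exact (unl_lidc (castlr_ceq _ _ _))).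
  - exact hcomp.
  - exact hunit.
  (* On the left the two whiskered comparisons are loose identities and cancel in turn, leaving
     [tlcomp F m n]; on the right the comparison stands last and cancels by [unl_lidc_r]. *)
  - abstract (intros;
      assert (e1 : npro (strict_data o c e) m • lidc (tpro G n)
        ≡ lidc (o x · tpro G m · tpro G n))
        by (apply lidc_comp_ceq; [apply castlr_ceq | constructor]);
      assert (e2 : lidc (tpro F m) • npro (strict_data o c e) n
        ≡ lidc (tpro F m · (o y · tpro G n)))
        by (apply lidc_comp_ceq; [constructor | apply castlr_ceq]);
      eapply ceq_trans; [exact (unl_ceq (unl_lidc e1))|];
      eapply ceq_trans; [exact (unl_ceq (castlr_ceq _ _ _))|];
      eapply ceq_trans; [exact (unl_lidc e2)|];
      eapply ceq_trans; [apply castlr_ceq|];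
      eapply ceq_trans; [apply hlcomp|];
      apply ceq_sym; exact (unl_lidc_r (castlr_ceq _ _ _))).
  - abstract (intros; eapply ceq_trans; [apply hlunit|];
      apply ceq_sym; exact (unl_lidc_r (castlr_ceq _ _ _))).
Defined.

Lemma strict_data_strict {F G : TwFun D Prof} o c e :
  is_strict (@strict_data F G o c e).
Proof. intros x y m; apply castlr_ceq. Qed.

Lemma strict_vcomp_npro {F G H : TwFun D Prof} (a : NatData F G)
  (b : NatData G H) : is_strict a -> is_strict b ->
  forall (x y : D) (m : pro x y),
  npro (nat_vcomp a b) m ≡ lidc (a x · (b x · tpro H m)).
Proof.
  intros ha hb x y m.
  eapply ceq_trans; [apply castlr_ceq|].
  assert (e1 : lidc (a x) • npro b m ≡ lidc (a x · (b x · tpro H m)))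
    by exact (lidc_comp_ceq ceq_refl (hb x y m)).
  assert (e2 : npro a m • lidc (b y) ≡ lidc (a x · tpro G m · b y))
    by exact (lidc_comp_ceq (ha x y m) ceq_refl).
  eapply ceq_trans; [exact (unl_lidc_r (ceq_trans (castlr_ceq _ _ _) e2))|].
  exact e1.
Qed.
End Strict.

(** Sharing the object map [o] avoids transporting hom-sets. By eta for records, [functor_ext_conv]
    applies it to any two functors whose object maps are convertible. *)
Lemma functor_ext {A B : Cat} {o : A -> B}
  {m m' : forall a b : A, hom a b -> hom (o a) (o b)} {p p' q q'} :
  (forall a b (u : hom a b), m a b u = m' a b u) ->
  {| fob := o; fmap := m; fmap1 := p; fmapM := q |}
  = {| fob := o; fmap := m'; fmap1 := p'; fmapM := q' |}.
Proof.
  intros h; assert (m = m') as e.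
  { do 3 (apply functional_extensionality_dep; intro); apply h. }
  destruct e; apply functor_irrel.
Qed.

Ltac functor_ext_conv :=
  match goal with |- ?F = ?G =>
    refine (@functor_ext _ _ (fob F) (@fmap _ _ F) (@fmap _ _ G)
      (fmap1 F) (fmap1 G) (fmapM F) (fmapM G) _) end.

(** * The transformation γ *)

Section Comparison.
Context {B : DblCat} {T : TwFun B Prof} (lax : is_lax T).

Definition gamma_ob (x : B) : Functor (el_cat T x) (twe_cat lax x).
Proof.
  refine {| fob := fun a : el_cat T x => a : twe_cat lax x;
            fmap := fun (a b : el_cat T x) (u : hom a b) => over_vert lax u |}.
  - abstract reflexivity.
  - abstract (intros; apply over_vert_mul).
Defined.

Definition gamma_arr (x z : B) (f : arr x z) :
  PCell (gamma_ob x) (el_prof T f) (twe_prof lax f) (gamma_ob z).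
Proof.
  refine {| pcell := fun a c (u : el_prof T f a c) => over_pair lax f u
              : twe_prof lax f (gamma_ob x a) (gamma_ob z c) |}.
  abstract (intros; symmetry; apply twe_pmap_vert).
Defined.

(** On arrows this is naturality of the comparison [T_x] with respect to [cone m]. *)
Lemma gamma_pro (x y : B) (m : pro x y) :
  functor_comp (gamma_ob x) (twe_fun lax m)
  = functor_comp (el_fun T m) (gamma_ob y).
Proof. functor_ext_conv; intros; apply twe_fun_vert. Qed.

Lemma gamma_comp (x y z : B) (f : arr x y) (g : arr y z) :
  (gamma_arr x y f : cell (d := Prof) _ _ _ _) ⊛ gamma_arr y z g
    • tcomp (TwElt T lax) f g
  ≡ tcomp T f g • gamma_arr x z (f · g).
Proof.
  prof_ceq; intros a c k; apply eq_JM; revert k; apply coend_ind; intros b u v.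
  simpl; rewrite pcell_lcomp_fun_tens; simpl; rewrite twe_tcomp_tens.
  apply over_comp_JM; reflexivity.
Qed.

(** The components for [TwElt] are by definition the vertical arrows on those of [T]. Each cell
    sends [u] to its image followed by a component, so functoriality of [gamma_ob] and
    [twe_fun_vert] suffice. *)
Lemma gamma_lcomp (x y z : B) (m : pro x y) (n : pro y z) :
  tlcomp T m n • lidc (gamma_ob z : arr (d := Prof) _ _)
  ≡ lidc (gamma_ob x : arr (d := Prof) _ _) • tlcomp (TwElt T lax) m n.
Proof.
  apply prof_ceq_gen; [functor_ext_conv|functor_ext_conv|reflexivity|].
  - intros a b u; simpl.
    etransitivity; [symmetry; apply (twe_fun_vert lax n)|].
    apply (f_equal (fmap (twe_fun lax n))); symmetry; apply twe_fun_vert.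
  - intros a b u; symmetry; apply twe_fun_vert.
  - intros a b u; apply eq_JM.
    etransitivity; [exact (f_equal (over_vert lax) (el_lcomp_cell m n u))|].
    etransitivity; [apply over_vert_mul|].
    change (over_vert lax (fmap (el_fun T n) (fmap (el_fun T m) u))
        ∘> over_vert lax (el_lcomp T m n b)
      = fmap (twe_fun lax n) (fmap (twe_fun lax m) (over_vert lax u))
        ∘> over_vert lax (el_lcomp T m n b)).
    now rewrite !twe_fun_vert.
Qed.

Lemma gamma_lunit (x : B) :
  tlunit T x • lidc (gamma_ob x : arr (d := Prof) _ _)
  ≡ lidc (gamma_ob x : arr (d := Prof) _ _) • tlunit (TwElt T lax) x.
Proof.
  apply prof_ceq_gen; [functor_conv|functor_ext_conv|reflexivity|].
  - intros a b u; symmetry; apply twe_fun_vert.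
  - intros a b u; apply eq_JM.
    etransitivity; [exact (f_equal (over_vert lax) (el_lunit_cell u))|].
    apply over_vert_mul.
Qed.

Definition gamma : LaxNat T (TwElt T lax).
Proof.
  refine (@strict_nat _ T (TwElt T lax) gamma_ob gamma_arr gamma_pro
    _ gamma_comp _ gamma_lcomp gamma_lunit).
  (* On elements both sides give the arrow [(g, el_act T s u)], by conversion. *)
  - abstract (intros; apply prof_ceq_gen;
      [apply gamma_pro | apply gamma_pro | reflexivity | reflexivity]).
  - abstract (intros; prof_ceq; reflexivity).
Defined.

(** The inverse of [over_pair]; the underlying arrow of [h] equals [f] only propositionally, hence
    the transport. *)
Definition over_elt {x z : B} {f : arr x z} {a c} (h : Over (lax := lax) f a c) :
  el_prof T f a c :=
  eq_rect _ (fun f0 => el_prof T f0 a c) (eelt (proj1_sig h)) f (proj2_sig h).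

Lemma over_eltK {x z : B} {f : arr x z} {a c} (h : Over (lax := lax) f a c) :
  over_pair lax f (over_elt h) = h.
Proof. revert h; apply over_ind; reflexivity. Qed.

Lemma over_elt_act {x y z w : B} {f : arr x z} {m : pro x y} {n : pro z w}
  {g : arr y w} (s : cell f m n g) {a c} (h : Over (lax := lax) f a c) :
  over_elt (over_act s h) = el_act T s (over_elt h).
Proof. revert h; apply over_ind; reflexivity. Qed.

(** * The inverse transformation δ *)

Context (normal : is_normal T).

Definition el_unitV {x : B} {a b : el_cat T x} (u : el_prof T (one x) a b) :
  hom a b :=
  pcell (proj1_sig (constructive_indefinite_description _ (normal x))) a b u.

Lemma el_unitK {x : B} {a b : el_cat T x} (u : hom a b) :
  el_unitV (el_unit T u) = u.
Proof.
  unfold el_unitV.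
  destruct (constructive_indefinite_description _ _) as [t [h h']].
  exact (JMeq_eq (prof_ceq_elim h (a := a) (b := b) (p := u) JMeq_refl)).
Qed.

Lemma el_unitVK {x : B} {a b : el_cat T x} (u : el_prof T (one x) a b) :
  el_unit T (el_unitV u) = u.
Proof.
  unfold el_unitV.
  destruct (constructive_indefinite_description _ _) as [t [h h']].
  exact (JMeq_eq (prof_ceq_elim h' (a := a) (b := b) (p := u) JMeq_refl)).
Qed.

Definition delta_hom {x : B} {a b : twe_cat lax x} (h : hom a b) :
  hom (a : el_cat T x) (b : el_cat T x) :=
  el_unitV (over_elt h).

Lemma delta_hom_vert {x : B} {a b : el_cat T x} (u : hom a b) :
  delta_hom (over_vert lax u) = u.
Proof. apply el_unitK. Qed.

Lemma over_vert_delta {x : B} {a b : twe_cat lax x} (h : hom a b) :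
  over_vert lax (delta_hom h) = h.
Proof.
  unfold over_vert, delta_hom; rewrite el_unitVK; apply over_eltK.
Qed.

(** Normality makes every arrow over an identity vertical, so claims about [delta_hom] reduce to
    facts about [over_vert], which it undoes. *)
Lemma vert_ind {x : B} {a b : twe_cat lax x} (X : hom a b -> Prop) :
  (forall u, X (over_vert lax u)) -> forall h, X h.
Proof. intros k h; rewrite <- over_vert_delta; apply k. Qed.

Lemma delta_hom_mul {x : B} {a b c : twe_cat lax x} (h : hom a b)
  (k : hom b c) : delta_hom (h ∘> k) = delta_hom h ∘> delta_hom k.
Proof.
  revert h; apply vert_ind; intros u; revert k; apply vert_ind; intros v.
  now rewrite <- over_vert_mul, !delta_hom_vert.
Qed.

Lemma delta_hom_fun {x y : B} (m : pro x y) {a b : twe_cat lax x} (h : hom a b) :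
  delta_hom (fmap (twe_fun lax m) h) = fmap (el_fun T m) (delta_hom h).
Proof.
  revert h; apply vert_ind; intros u.
  now rewrite twe_fun_vert, !delta_hom_vert.
Qed.

Definition delta_ob (x : B) : Functor (twe_cat lax x) (el_cat T x).
Proof.
  refine {| fob := fun a : twe_cat lax x => a : el_cat T x;
            fmap := fun (a b : twe_cat lax x) (h : hom a b) => delta_hom h |}.
  - abstract (intros; apply (delta_hom_vert (idm _))).
  - abstract (intros; apply delta_hom_mul).
Defined.

Definition delta_arr (x z : B) (f : arr x z) :
  PCell (delta_ob x) (twe_prof lax f) (el_prof T f) (delta_ob z).
Proof.
  refine {| pcell := fun a c (h : twe_prof lax f a c) => over_elt h
              : el_prof T f (delta_ob x a) (delta_ob z c) |}.
  (* Once both acting arrows are vertical, their action is that of [T] on the second component. *)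
  abstract (intros a a' c c' h k p; revert h; apply vert_ind; intros u;
    revert k; apply vert_ind; intros v; revert p; apply over_ind; intros p;
    rewrite twe_pmap_vert; simpl fmap; rewrite !delta_hom_vert; reflexivity).
Defined.

Lemma delta_pro (x y : B) (m : pro x y) :
  functor_comp (delta_ob x) (el_fun T m)
  = functor_comp (twe_fun lax m) (delta_ob y).
Proof. functor_ext_conv; intros; symmetry; apply delta_hom_fun. Qed.

Lemma delta_comp (x y z : B) (f : arr x y) (g : arr y z) :
  (delta_arr x y f : cell (d := Prof) _ _ _ _) ⊛ delta_arr y z g
    • tcomp T f g
  ≡ tcomp (TwElt T lax) f g • delta_arr x z (f · g).
Proof.
  prof_ceq; intros a c k; apply eq_JM; revert k; apply coend_ind; intros b u v.
  simpl; rewrite pcell_lcomp_fun_tens; simpl; rewrite twe_tcomp_tens.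
  revert u; apply over_ind; intros u; revert v; apply over_ind; intros v.
  now rewrite (over_comp_JM lax eq_refl (w := el_comp T u v) JMeq_refl).
Qed.

(** [delta_hom] preserves composites, commutes with the functors [m_!], and sends the vertical
    component back to [el_lcomp]. *)
Lemma delta_lcomp (x y z : B) (m : pro x y) (n : pro y z) :
  tlcomp (TwElt T lax) m n • lidc (delta_ob z : arr (d := Prof) _ _)
  ≡ lidc (delta_ob x : arr (d := Prof) _ _) • tlcomp T m n.
Proof.
  apply prof_ceq_gen; [functor_ext_conv|functor_ext_conv|reflexivity|].
  - intros a b u.
    etransitivity; [apply (delta_hom_fun n)|].
    apply (f_equal (fmap (el_fun T n))), delta_hom_fun.
  - intros a b u; apply delta_hom_fun.
  - intros a b u; apply eq_JM.
    etransitivity; [|symmetry; exact (el_lcomp_cell m n (delta_hom u))].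
    etransitivity; [apply delta_hom_mul|].
    refine (f_equal2 mul _ (delta_hom_vert _)).
    etransitivity; [apply (delta_hom_fun n)|].
    apply (f_equal (fmap (el_fun T n))), delta_hom_fun.
Qed.

Lemma delta_lunit (x : B) :
  tlunit (TwElt T lax) x • lidc (delta_ob x : arr (d := Prof) _ _)
  ≡ lidc (delta_ob x : arr (d := Prof) _ _) • tlunit T x.
Proof.
  apply prof_ceq_gen; [functor_conv|functor_ext_conv|reflexivity|].
  - intros a b u; apply delta_hom_fun.
  - intros a b u; apply eq_JM.
    etransitivity; [|symmetry; exact (el_lunit_cell (delta_hom u))].
    etransitivity; [apply delta_hom_mul|].
    exact (f_equal (mul (delta_hom u)) (delta_hom_vert _)).
Qed.

Definition delta : LaxNat (TwElt T lax) T.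
Proof.
  refine (@strict_nat _ (TwElt T lax) T delta_ob delta_arr delta_pro
    _ delta_comp _ delta_lcomp delta_lunit).
  - abstract (intros; apply prof_ceq_gen;
      [apply delta_pro | apply delta_pro | reflexivity |];
      intros; apply eq_JM; symmetry; apply over_elt_act).
  (* Compatibility with units says that [T_x] applied after its inverse is the identity. *)
  - abstract (intros; prof_ceq; intros; apply eq_JM; apply el_unitVK).
Defined.

(** * Invertibility of γ *)

Lemma gamma_delta_ob (x : B) :
  functor_comp (gamma_ob x) (delta_ob x) = functor_id (el_cat T x).
Proof. functor_ext_conv; intros; apply delta_hom_vert. Qed.

Lemma delta_gamma_ob (x : B) :
  functor_comp (delta_ob x) (gamma_ob x) = functor_id (twe_cat lax x).
Proof. functor_ext_conv; intros; apply over_vert_delta. Qed.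

Lemma gamma_invertible : nat_invertible gamma.
Proof.
  assert (sg : is_strict gamma) by apply strict_data_strict.
  assert (sd : is_strict delta) by apply strict_data_strict.
  exists delta; repeat split.
  - exact gamma_delta_ob.
  - intros x y f; apply prof_ceq_gen;
      [apply gamma_delta_ob | apply gamma_delta_ob | reflexivity |].
    intros; reflexivity.
  - intros x y m.
    eapply ceq_trans; [exact (strict_vcomp_npro _ _ sg sd _ _ m)|].
    eapply ceq_trans; [|exact (ceq_sym (castlr_ceq _ _ _))].
    (* Both comparisons are loose identities, so only their arrows are compared: the inverse law on
       objects, composed with [tpro T m]. *)
    apply lidc_ceq; rewrite <- acompA.
    etransitivity; [|apply acomp1l].
    exact (f_equal (fun F : arr (d := Prof) _ _ => F · tpro T m)
      (gamma_delta_ob x)).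
  - exact delta_gamma_ob.
  - intros x y f; apply prof_ceq_gen;
      [apply delta_gamma_ob | apply delta_gamma_ob | reflexivity |].
    intros; apply eq_JM, over_eltK.
  - intros x y m.
    eapply ceq_trans; [exact (strict_vcomp_npro _ _ sd sg _ _ m)|].
    eapply ceq_trans; [|exact (ceq_sym (castlr_ceq _ _ _))].
    apply lidc_ceq; rewrite <- acompA.
    etransitivity; [|apply acomp1l].
    exact (f_equal (fun F : arr (d := Prof) _ _ => F · tpro (TwElt T lax) m)
      (delta_gamma_ob x)).
Qed.
End Comparison.

Theorem proposition6p9 (B : DblCat) (T : TwFun B Prof)
  (lax : is_lax T) (normal : is_normal T) :
  exists gamma : LaxNat T (TwElt T lax),
    (forall (x : B) (a : el_cat T x),
       elt_pt T x (fob (gamma x) a) = elt_pt T x a)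
    /\ (forall (x : B) (a b : el_cat T x) (u : hom a b),
       over_arrow (fmap (gamma x) u) = elt_pair T lax (one x) (el_unit T u))
    /\ (forall (x z : B) (f : arr x z) (a : el_cat T x) (c : el_cat T z)
         (u : el_prof T f a c),
       over_arrow (pcell (narr gamma f) a c u) = elt_pair T lax f u)
    /\ is_strict gamma
    /\ nat_invertible gamma.
Proof.
  (* The three explicit formulas hold by conversion and are closed by [split]. *)
  exists (gamma lax); repeat split.
  - apply strict_data_strict.
  - exact (gamma_invertible lax normal).
Qed.
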